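(* Let $d\ge 2$, $q\ge 1$ and $p\in[0,1]$ be such that the random-cluster model on $\mathbb Z^d$ with parameters $(p,q)$ satisfies weak spatial mixing (WSM). Then the mixing time of the FK dynamics on the torus $\mathbb T_n=(\mathbb Z/n\mathbb Z)^d$ is $O(N\log N)$, where $N=n^d$ is the number of vertices (equivalently, in the paper's continuous-time restatement, the mixing time of the continuous-time FK dynamics on $\mathbb T_n$ is $O(\log N)$). The implied constant may depend on $p,q,d$ but not on $n$.
   Context: Random-cluster model: for a finite graph $G=(V,E)$, $p\in[0,1]$, $q\ge1$, $\pi_{G,p,q}(\omega)\propto p^{|\omega|}(1-p)^{|E|-|\omega|}q^{|\mathrm{Comp}(\omega)|}$ for $\omega\subseteq E$, where $\mathrm{Comp}(\omega)$ is the set of connected components of $(V,\omega)$. $\Lambda_n=[-\frac n2,\frac n2]^d\cap\mathbb Z^d$ with its nearest-neighbor edges; $\partial\Lambda_n$ is the set of vertices of $\Lambda_n$ having a neighbor in $\mathbb Z^d\setminus\Lambda_n$. A boundary condition $\xi$ is a partition of $\partial\Lambda_n$; $\pi_{\Lambda_n^\xi}$ is defined in the same way, with components counted after identifying vertices in the same class of $\xi$. The free condition $\mathbf 0$ is the partition into singletons; the wired condition $\mathbf 1$ has a single class. WSM: there is a constant $C>0$ (depending on $d,q,p$) such that for every $r$, $\|\pi_{\Lambda_r^{\mathbf 1}}(\omega(\Lambda_{r/2})\in\cdot)-\pi_{\Lambda_r^{\mathbf 0}}(\omega(\Lambda_{r/2})\in\cdot)\|_{TV}\le Ce^{-r/C}$,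 where $\omega(\Lambda_{r/2})$ is the restriction of $\omega$ to the edges of $\Lambda_{r/2}$. FK dynamics (discrete time): at each step pick $e\in E$ uniformly at random and, given the current configuration $\omega$, make $e$ open with probability $\frac{p}{q(1-p)+p}$ if $e$ is a bridge in $\omega\cup\{e\}$ (i.e. $|\mathrm{Comp}(\omega\setminus\{e\})|\neq|\mathrm{Comp}(\omega\cup\{e\})|$) and with probability $p$ otherwise; else make $e$ closed. In continuous time each edge has an independent rate-1 Poisson clock and is updated by this rule when its clock rings. The mixing time is the least $t$ such that $\max_{x_0}\|\mathbb P(X_t^{x_0}\in\cdot)-\pi\|_{TV}\le 1/4$. *)

(* Defs.v *)
From mathcomp Require Import all_boot all_order all_algebra.
From mathcomp Require Import all_classical all_reals all_analysis.
Import Order.TTheory GRing.Theory Num.Theory numFieldNormedType.Exports.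

Set Implicit Arguments.
Unset Strict Implicit.
Unset Printing Implicit Defensive.

Local Open Scope ring_scope.

Section FiniteLaws.
Variables (R : realType) (T : finType).

(* Laws on T are given by their mass functions T -> R. *)
Definition mass (mu : T -> R) (A : {set T}) : R := \sum_(x in A) mu x.

Definition tv_dist (mu nu : T -> R) : R :=
  \big[Num.max/0]_(A : {set T}) `|mass mu A - mass nu A|.

Definition pushforward (T' : finType) (f : T -> T') (mu : T -> R) : T' -> R :=
  fun y => mass mu [set x | f x == y].

Definition dist_to_equilibrium (P : T -> T -> R) (pi : T -> R) : R :=
  \big[Num.max/0]_(x0 : T) tv_dist (P x0) pi.

Fixpoint law_after (K : T -> T -> R) (k : nat) (x0 : T) : T -> R :=
  if k is k'.+1 then fun y => \sum_(x : T) law_after K k' x0 x * K x y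
  else fun y => (y == x0)%:R.

(* Law at time t of the jump chain K run at the rings of a Poisson clock of
   the given rate. *)
Definition law_at (K : T -> T -> R) (rate t : R) (x0 : T) : T -> R :=
  fun y => limn (series (fun k : nat =>
    expR (- (rate * t)) * (rate * t) ^+ k / k`!%:R * law_after K k x0 y)).

(* The mixing times are infima in \bar R: they equal +oo when the
   1/4-threshold is never reached, and are attained otherwise. *)
Definition mixing_time (K : T -> T -> R) (pi : T -> R) : \bar R :=
  ereal_inf [set (k%:R)%:E | k in
    [set k : nat | dist_to_equilibrium (law_after K k) pi <= 4%:R^-1]]%classic.

Definition mixing_time_cont (K : T -> T -> R) (rate : R) (pi : T -> R) :
    \bar R :=
  ereal_inf [set t%:E | t in
    [set t : R | 0 <= t /\
       dist_to_equilibrium (law_at K rate t) pi <= 4%:R^-1]]%classic.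

End FiniteLaws.

(* Simple graphs are given by an adjacency relation, symmetric and irreflexive
   in all uses below; edges are unordered pairs of adjacent vertices. *)
Section RandomCluster.
Variables (R : realType) (p q : R) (V : finType) (adj : rel V).

Definition edge_set : {set {set V}} :=
  [set [set xy.1; xy.2] | xy in [pred xy : V * V | adj xy.1 xy.2]].

Definition edge : finType := {e : {set V} | e \in edge_set}.

(* A configuration is identified with its set of open edges. *)
Definition config : finType := {set edge}.

Implicit Types (xi : {set {set V}}) (omega : config) (e : edge).

(* Vertices lying in a common class of xi are identified; xi is a partition of
   a subset of V, and set0 (like a partition into singletons) identifies
   nothing. *)
Definition linked xi omega : rel V := fun x y =>
  [exists e in omega, val e == [set x; y]]
  || [exists B in xi, (x \in B) && (y \in B)].

Definition ncomp xi omega : nat := n_comp (linked xi omega) predT.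

Definition fk_weight xi omega : R :=
  p ^+ #|omega| * (1 - p) ^+ (#|edge| - #|omega|) * q ^+ ncomp xi omega.

Definition fk_measure xi omega : R :=
  fk_weight xi omega / \sum_(omega' : config) fk_weight xi omega'.

Definition is_bridge xi omega e : bool :=
  ncomp xi (omega :\ e) != ncomp xi (e |: omega).

Definition open_prob xi omega e : R :=
  if is_bridge xi omega e then p / (q * (1 - p) + p) else p.

Definition fk_update xi e omega omega' : R :=
  open_prob xi omega e * (omega' == e |: omega)%:R
  + (1 - open_prob xi omega e) * (omega' == omega :\ e)%:R.

Definition fk_kernel xi omega omega' : R :=
  #|edge|%:R^-1 * \sum_(e : edge) fk_update xi e omega omega'.

Definition fk_mixing_time : \bar R :=
  mixing_time (fk_kernel finset.set0) (fk_measure finset.set0).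

(* Superposing the independent rate-1 clocks of the edges gives a clock of rate
   #|edge|, each ring of which belongs to an independent uniform edge. *)
Definition fk_mixing_time_cont : \bar R :=
  mixing_time_cont (fk_kernel finset.set0) #|edge|%:R
    (fk_measure finset.set0).

End RandomCluster.

Section Boxes.
Variable d : nat.

Definition Zd : choiceType := {ffun 'I_d -> int}.

Definition nearest_neighbor (x y : Zd) : bool :=
  (\sum_(i < d) `|x i - y i|%N == 1)%N.

(* Membership in [-n/2, n/2]^d. *)
Definition in_Lambda (n : nat) (x : Zd) : bool :=
  [forall i, (2 * `|x i| <= n)%N].

(* Lambda n indexes the points of [-n/2, n/2]^d: the integers z with
   2|z| <= n are the k - n./2 with 0 <= k <= 2 (n./2). *)
Definition Lambda (n : nat) : finType := {ffun 'I_d -> 'I_(n./2).*2.+1}.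

Definition position (n : nat) (x : Lambda n) : Zd :=
  [ffun i => (x i)%:Z - (n./2)%:Z].

Definition Lambda_adj (n : nat) : rel (Lambda n) :=
  fun x y => nearest_neighbor (position x) (position y).

Definition boundary (n : nat) : {set Lambda n} :=
  [set x | `[< exists y : Zd,
     nearest_neighbor (position x) y /\ ~~ in_Lambda n y >]].

Definition free_bc (n : nat) : {set {set Lambda n}} :=
  [set [set x] | x in boundary n].

Definition wired_bc (n : nat) : {set {set Lambda n}} := [set boundary n].

(* The edges of Lambda_r inside Lambda_(r/2); an integer z has 2|z| <= r/2
   exactly when 2|z| <= r./2. *)
Definition inner_edges (r : nat) : {set edge (@Lambda_adj r)} :=
  [set e : edge (@Lambda_adj r) |
    [forall x : Lambda r, (x \in val e) ==> in_Lambda r./2 (position x)]].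

Definition inner_law (R : realType) (p q : R) (r : nat)
    (xi : {set {set Lambda r}}) : config (@Lambda_adj r) -> R :=
  pushforward (fun omega : config (@Lambda_adj r) => omega :&: inner_edges r)
    (@fk_measure R p q _ (@Lambda_adj r) xi).

Definition weak_spatial_mixing (R : realType) (p q : R) : Prop :=
  exists C : R, 0 < C /\ forall r : nat,
    tv_dist (inner_law p q (wired_bc r)) (inner_law p q (free_bc r))
      <= C * expR (- (r%:R / C)).

End Boxes.

Section Torus.
Variables (d n : nat).

Definition torus : finType := {ffun 'I_d -> 'I_n}.

(* ordS is the cyclic successor on 'I_n. For n = 2 this is a simple graph,
   with a single edge between x and x + e_i. *)
Definition torus_adj : rel torus := fun x y =>
  [exists i, ((y i == ordS (x i)) || (x i == ordS (y i)))
             && [forall j, (j != i) ==> (x j == y j)]].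

End Torus.

(* Main.v *)
Require Import Defs.
From mathcomp Require Import all_boot all_order all_algebra.
From mathcomp Require Import all_classical all_reals all_analysis.
From mathcomp Require Import ring lra zify.
Import Order.TTheory GRing.Theory Num.Theory numFieldNormedType.Exports.
(* Finite-set lemmas take precedence over their namesakes on classical sets. *)
Import mathcomp.boot.fintype mathcomp.boot.finset.

(** The argument is a monotone coupling in discrete time, turned into a
    quadratic recursion in time.

    An edge update is performed with a three-sided coin [coin]: open the edge
    unconditionally, close it unconditionally, or open it exactly when it would
    not be a bridge.  This lets one random word of (edge, coin) pairs drive the
    chains from all initial states at once, and every update is monotone, since
    adding edges only helps connections ([cycle_rule_mono]).  Chains started
    from any two states are squeezed between those started from the full and the
    empty configuration, so everything is controlled by [gap k e], the
    probability that these two extreme chains differ at [e] after [k] steps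
    ([trans_gap]).

    Connectivity is a long-range constraint, so there is no finite speed of
    propagation.  What replaces it is comparison with a box: driven by the same
    word, the wired chain on a box placed in the torus stays above the torus
    chain, and the free one below, whatever happens outside the box
    ([cycle_rule_wired], [cycle_rule_free]).  Let [eps r] be the distance between
    the wired and free laws in the middle of the box of size [r], exponentially
    small by hypothesis.  Two estimates follow.
    - [gap_small_time]: for a fixed box, the gap at its centre is at most
      [eps r] plus the relaxation error of a finite chain, which decays at a rate
      depending only on the box ([trans_near_invariant]).
    - [gap_doubling]: if all gaps at time [k] are at most [b], then at time [2k]
      they are at most [|E(box)| b^2 + eps r].  Run the extreme chains together
      with a stationary torus chain for time [k].  Either the extreme chains
      disagree somewhere in the box, which costs [|E(box)| b], and then the gap of
      the next [k] steps costs another factor [b]; or all three agree there, and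
      the next [k] steps are sandwiched between the wired and free box chains
      from one common state, whose law is itself sandwiched between the two
      stationary box laws, so that only [eps r] is lost.

    Running this along [r = 2^j r0] and [k = 2^j k0], the bound
    [exp(-c r) / (al r^D)], with [D = 2d], reproduces itself
    ([torus_gap_scales]).  Space and time grow at the same speed, hence the gap
    decays exponentially in [k/|E|], and a box of logarithmic size suffices to
    bring the sum of all gaps below 1/8 after a number of steps of order
    [|E| log N] ([torus_gap_log_time]).  The finitely many small tori are absorbed
    in the constant.  For continuous time, a Poisson clock of mean [8k] has rung
    fewer than [k] times with probability at most 1/8
    ([poisson_tail_bound]). *)

Set Implicit Arguments.
Unset Strict Implicit.
Unset Printing Implicit Defensive.

Local Open Scope ring_scope.

(** * Expectations over random words and dynamics driven by them *)

Section WordExpectation.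
Variables (R : realType) (I : finType) (mu : I -> R).
Hypotheses (mu_ge0 : forall i, 0 <= mu i) (mu_sum1 : \sum_i mu i = 1).

(** Defined by recursion on the first letter, so that no measure on words is
    needed and the Markov property is [wordE_cat]. *)
Fixpoint wordE (k : nat) (F : seq I -> R) : R :=
  if k is k'.+1 then \sum_i mu i * wordE k' (fun w => F (i :: w)) else F [::].

Lemma eq_wordE k F G : F =1 G -> wordE k F = wordE k G.
Proof.
elim: k F G => [|k IH] F G FG /=; first exact: FG.
by apply: eq_bigr => i _; congr (_ * _); apply: IH => w; exact: FG.
Qed.

Lemma ler_wordE k F G : (forall w, F w <= G w) -> wordE k F <= wordE k G.
Proof.
elim: k F G => [|k IH] F G FG /=; first exact: FG.
by apply: ler_sum => i _; apply: ler_wpM2l => //; apply: IH.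
Qed.

Lemma wordE_cst k c : wordE k (fun=> c) = c.
Proof.
by elim: k => [//|k IH] /=; rewrite -mulr_suml mu_sum1 mul1r.
Qed.

Lemma wordED k F G : wordE k (fun w => F w + G w) = wordE k F + wordE k G.
Proof.
elim: k F G => [//|k IH] F G /=; rewrite -big_split /=.
by apply: eq_bigr => i _; rewrite IH mulrDr.
Qed.

Lemma wordEZ k c F : wordE k (fun w => c * F w) = c * wordE k F.
Proof.
elim: k F => [//|k IH] F /=; rewrite mulr_sumr.
by apply: eq_bigr => i _; rewrite IH mulrCA.
Qed.

Lemma wordEB k F G : wordE k (fun w => F w - G w) = wordE k F - wordE k G.
Proof.
rewrite -[in RHS]mulN1r -wordEZ -wordED.
by apply: eq_wordE => w; rewrite mulN1r.
Qed.

Lemma wordE_sum (T : finType) (P : pred T) k (F : T -> seq I -> R) :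
  wordE k (fun w => \sum_(x | P x) F x w) = \sum_(x | P x) wordE k (F x).
Proof.
elim: k F => [//|k IH] F /=; rewrite exchange_big /=.
by apply: eq_bigr => i _; rewrite IH mulr_sumr.
Qed.

Lemma wordE_cat k l F :
  wordE (k + l) F = wordE k (fun w => wordE l (fun v => F (w ++ v))).
Proof.
elim: k F => [//|k IH] F; rewrite addSn /=.
by apply: eq_bigr => i _; rewrite IH.
Qed.

End WordExpectation.

Section SingleSite.
Variables (R : realType) (th : option bool -> R).
Hypotheses (th_ge0 : forall s, 0 <= th s) (th_sum1 : \sum_s th s = 1).
Variable J : finType.
Hypothesis J_gt0 : (0 < #|J|)%N.

(** The law of a uniform site together with an independent coin. *)
Definition clock (i : J * option bool) : R := #|J|%:R^-1 * th i.2.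

Lemma clock_ge0 i : 0 <= clock i.
Proof. by rewrite mulr_ge0 ?invr_ge0 ?ler0n. Qed.

Lemma clock_sum (F : J * option bool -> R) :
  \sum_i clock i * F i = #|J|%:R^-1 * \sum_j \sum_s th s * F (j, s).
Proof.
rewrite mulr_sumr; under [RHS]eq_bigr do rewrite mulr_sumr.
by rewrite pair_big /=; apply: eq_bigr => -[j s] _; rewrite /clock /= mulrA.
Qed.

Lemma natJ_neq0 : #|J|%:R != 0 :> R.
Proof. by rewrite pnatr_eq0 -lt0n. Qed.

Lemma clock_sum1 : \sum_i clock i = 1.
Proof.
under eq_bigr do rewrite -[clock _]mulr1.
rewrite clock_sum; under eq_bigr do under eq_bigr do rewrite mulr1.
by under eq_bigr do rewrite th_sum1; rewrite sumr_const mulVf ?natJ_neq0.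
Qed.

Section Dynamics.
Variable S : finType.
Implicit Types (x y z : {set S}) (f : {set S} -> R) (r : {set S} -> S -> bool).

Definition force (b : bool) e x := if b then e |: x else x :\ e.

Definition heat r e (s : option bool) x :=
  force (if s is Some b then b else r x e) e x.

(** The driving sites [J] may be more numerous than the sites [S] of the
    system: [loc] tells which ring, if any, concerns the system.  A box driven by
    the clocks of the torus ignores the rings outside it, which lets it be
    coupled step by step with the torus. *)
Definition driven r (loc : J -> option S) x (i : J * option bool) :=
  if loc i.1 is Some e then heat r e i.2 x else x.

Definition run r loc x (w : seq (J * option bool)) := foldl (driven r loc) x w.

(** The transition operator after [k] steps; all initial states share the
    words over which the expectation is taken. *)
Definition trans r loc k f x := wordE clock k (fun w => f (run r loc x w)).

Definition monotone_rule r := forall x y e, x \subset y -> r x e -> r y e.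

Definition open_at e x : R := (e \in x)%:R.

Lemma in_force b e x g : (g \in force b e x) = if g == e then b else g \in x.
Proof.
by rewrite /force; case: b; rewrite !inE; case: (g == e).
Qed.

Lemma heat_sub r r' e s x y : (forall z e, r z e -> r' z e) ->
  monotone_rule r -> x \subset y -> heat r e s x \subset heat r' e s y.
Proof.
move=> rr' mr xy; apply/subsetP => g; rewrite /heat !in_force.
case: eqP => _; last exact: (subsetP xy).
by case: s => // /(mr _ _ _ xy); exact: rr'.
Qed.

Lemma run_sub r loc x y w : monotone_rule r ->
  x \subset y -> run r loc x w \subset run r loc y w.
Proof.
move=> mr; elim: w x y => [//|i w IH] x y xy /=; apply: IH.
by rewrite /driven; case: loc => // e; exact: heat_sub.
Qed.

Lemma open_at_le e x y : x \subset y -> open_at e x <= open_at e y.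
Proof. by move=> /subsetP xy; rewrite ler_nat; case: (boolP (e \in x)) => // /xy ->. Qed.

Lemma ler_trans_rule r loc k f f' x : (forall z, f z <= f' z) ->
  trans r loc k f x <= trans r loc k f' x.
Proof. by move=> ff'; apply: ler_wordE => [i|w]; rewrite ?clock_ge0. Qed.

Definition increasing f := forall x y, x \subset y -> f x <= f y.

Lemma trans_increasing r loc k f : monotone_rule r ->
  increasing f -> increasing (trans r loc k f).
Proof.
move=> mr If x y xy; apply: ler_wordE => [i|w]; first exact: clock_ge0.
exact/If/run_sub.
Qed.

Lemma trans_add r loc k l f x :
  trans r loc (k + l) f x = trans r loc k (trans r loc l f) x.
Proof.
rewrite /trans wordE_cat; apply: eq_wordE => w; apply: eq_wordE => v.
by rewrite /run foldl_cat.
Qed.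

Lemma trans_cst r loc k c x : trans r loc k (fun=> c) x = c.
Proof. by rewrite /trans wordE_cst ?clock_sum1. Qed.

Lemma trans_bound r loc k f x : (forall z, 0 <= f z <= 1) ->
  0 <= trans r loc k f x <= 1.
Proof.
move=> f01; apply/andP; split.
  by rewrite -(trans_cst r loc k 0 x) ler_trans_rule // => z; case/andP: (f01 z).
by rewrite -(trans_cst r loc k 1 x) ler_trans_rule // => z; case/andP: (f01 z).
Qed.

(** For a monotone rule this is the probability that the chains from the full
    and the empty configuration differ at [e] at time [k]. *)
Definition gap r loc k e :=
  trans r loc k (open_at e) [set: S] - trans r loc k (open_at e) set0.

(** Invariance under the update of each single site, which is what the
    heat-bath rule gives; it implies invariance whatever the clocks are. *)
Definition invariant_law r (pi : {set S} -> R) := forall e f,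
  \sum_x pi x * \sum_s th s * f (heat r e s x) = \sum_x pi x * f x.

Lemma trans_invariant r loc pi k f : invariant_law r pi ->
  \sum_x pi x * trans r loc k f x = \sum_x pi x * f x.
Proof.
move=> inv; elim: k f => [//|k IH] f.
rewrite -[RHS]IH /trans /=.
under eq_bigr => x _ do rewrite clock_sum mulr_sumr mulr_sumr.
rewrite exchange_big /=.
pose F x := trans r loc k f x.
transitivity (\sum_(j : J) #|J|%:R^-1 * \sum_x pi x * F x).
  apply: eq_bigr => j _; rewrite /driven /=.
  under eq_bigr => x _ do rewrite mulrCA.
  rewrite -mulr_sumr; congr (_ * _).
  case: (loc j) => [e|]; first exact: (inv e F).
  by apply: eq_bigr => x _; rewrite -mulr_suml th_sum1 mul1r.
by rewrite sumr_const -[LHS]mulr_natl mulrA mulfV ?natJ_neq0 ?mul1r.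
Qed.

End Dynamics.
End SingleSite.

(** * Coalescence of two chains with the same randomness *)

Lemma expR_small (R : realType) (a e : R) : 0 < a -> 0 < e ->
  exists k : nat, expR (- (a * k%:R)) <= e.
Proof.
move=> a0 e0; exists (Num.bound `|- ln e / a|).
rewrite -[leRHS]lnK ?posrE // ler_expR lerNl mulrC -ler_pdivrMr //.
exact/ltW/(le_lt_trans (ler_norm _))/archi_boundP/normr_ge0.
Qed.

Section Coalescence.
Variables (R : realType) (th : option bool -> R).
Hypotheses (th_ge0 : forall s, 0 <= th s) (th_sum1 : \sum_s th s = 1).
Hypothesis th_free : th None < 1.
Variables (J S : finType) (loc : J -> option S) (emb : S -> J).
Hypotheses (J_gt0 : (0 < #|J|)%N) (embK : pcancel emb loc)
  (locK : ocancel loc emb).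
Variable r : {set S} -> S -> bool.
Implicit Types (x y z : {set S}) (f : {set S} -> R).

Definition disagreement x y := [set e | (e \in x) != (e \in y)].

(** Small enough, against the number of sites, for the forced updates to
    outweigh the unforced ones in [potential_step]. *)
Definition coalescence_base (M : nat) : R := (1 - th None) / (M.+1.*2)%:R.
Definition coalescence_rate (M : nat) : R :=
  coalescence_base M ^+ M * ((1 - th None) / 2).

Let be := coalescence_base #|S|.
Let ka := coalescence_rate #|S|.
(** A concave increasing function of the number of disagreements.  Steep
    concavity makes one repaired disagreement worth more than the disagreements
    that unforced updates may create elsewhere. *)
Definition potential x y : R := 1 - be ^+ #|disagreement x y|.

Lemma th_free_ge0 : 0 <= 1 - th None <= 1.
Proof. by rewrite subr_ge0 ltW //= gerBl. Qed.

Lemma base_gt0 M : 0 < coalescence_base M.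
Proof. by rewrite divr_gt0 ?subr_gt0 ?ltr0n ?double_gt0. Qed.

Lemma base_mul M : M%:R * coalescence_base M <= (1 - th None) / 2.
Proof.
have /andP[g0 _] := th_free_ge0.
rewrite /coalescence_base mulrCA ler_wpM2l // ler_pdivrMr ?ltr0n ?double_gt0 //.
by rewrite -muln2 natrM mulrCA mulVf // mulr1 ler_nat.
Qed.

Lemma base_half M : coalescence_base M <= 2^-1.
Proof.
have /andP[g0 g1] := th_free_ge0.
rewrite /coalescence_base ler_pdivrMr ?ltr0n ?double_gt0 //.
by rewrite -muln2 natrM mulrCA mulVf // mulr1 (le_trans g1) // ler1n.
Qed.

Lemma coalescence_rate_gt0 M : 0 < coalescence_rate M.
Proof. by rewrite mulr_gt0 ?exprn_gt0 ?base_gt0 // divr_gt0 ?subr_gt0. Qed.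

Lemma coalescence_rate_le1 M : coalescence_rate M <= 1.
Proof.
have /andP[g0 g1] := th_free_ge0; have b0 := base_gt0 M.
have b2 := base_half M.
rewrite /coalescence_rate mulr_ile1 ?exprn_ge0 ?exprn_ile1 //; lra.
Qed.

Let be_gt0 : 0 < be. Proof. exact: base_gt0. Qed.
Let be_half : be <= 2^-1. Proof. exact: base_half. Qed.
Let be_le1 : be <= 1. Proof. by have := be_half; lra. Qed.

Lemma disagreement0 x : #|disagreement x x| = 0%N.
Proof. by apply: eq_card0 => e; rewrite !inE eqxx. Qed.

Lemma disagreement_gt0 x y : x != y -> (0 < #|disagreement x y|)%N.
Proof.
rewrite lt0n; apply: contraNneq => /cards0_eq D0; apply/eqP/setP => e.
by move/setP/(_ e): D0; rewrite !inE => /negbFE/eqP.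
Qed.

Lemma potential_xx x : potential x x = 0.
Proof. by rewrite /potential disagreement0 subrr. Qed.

Lemma potential_ge0 x y : 0 <= potential x y.
Proof. by rewrite subr_ge0 exprn_ile1 ?(ltW be_gt0). Qed.

Lemma potential_le1 x y : potential x y <= 1.
Proof. by rewrite gerBl exprn_ge0 ?(ltW be_gt0). Qed.

Lemma potential_half x y : x != y -> 2^-1 <= potential x y.
Proof.
move=> /disagreement_gt0; rewrite /potential; case: #|_| => // n _.
have : be ^+ n.+1 <= 2^-1.
  rewrite exprS; apply: le_trans be_half.
  by rewrite ler_piMr ?(ltW be_gt0) // exprn_ile1 ?(ltW be_gt0).
lra.
Qed.

Lemma potential_le n x y : (#|disagreement x y| <= n)%N ->
  potential x y <= 1 - be ^+ n.
Proof.
move=> le_n; rewrite lerB // -(subnK le_n) exprD.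
by rewrite ler_piMl ?exprn_ge0 ?exprn_ile1 ?(ltW be_gt0).
Qed.

Lemma potential_forced e b x y :
  potential (heat r e (Some b) x) (heat r e (Some b) y)
    <= 1 - be ^+ (#|disagreement x y| - (e \in disagreement x y)).
Proof.
apply: potential_le; rewrite (cardsD1 e (disagreement x y)) addKn.
apply: subset_leq_card; apply/subsetP => g.
by rewrite !inE /heat !in_force; case: (g == e) => //; rewrite eqxx.
Qed.

Lemma potential_unforced e x y :
  potential (heat r e None x) (heat r e None y)
    <= 1 - be ^+ #|disagreement x y|.+1.
Proof.
apply: potential_le.
apply: (@leq_trans #|e |: disagreement x y|); last first.
  by rewrite cardsU1; case: (e \notin _).
apply: subset_leq_card; apply/subsetP => g.
by rewrite !inE /heat !in_force; case: (g == e).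
Qed.

(** A forced update at a disagreement removes it; an unforced update adds at
    most one. *)
Lemma potential_site e x y : x != y ->
  \sum_s th s * potential (heat r e s x) (heat r e s y)
    <= potential x y + (be ^+ #|disagreement x y|
       - (e \in disagreement x y)%:R * (1 - th None)
         * be ^+ #|disagreement x y|.-1).
Proof.
move=> xy; set n := #|_|; set c := (e \in _).
have n_gt0 : (0 < n)%N by exact: disagreement_gt0.
have /andP[g0 g1] := th_free_ge0.
apply: (@le_trans _ _ (\sum_s th s *
    (if s is Some _ then 1 - be ^+ (n - c) else 1 - be ^+ n.+1))).
  apply: ler_sum => -[b|] _; rewrite ler_wpM2l //.
    exact: potential_forced.
  exact: potential_unforced.
rewrite (bigD1 None) //=.
have -> : \sum_(s | s != None) th s *
    (if s is Some _ then 1 - be ^+ (n - c) else 1 - be ^+ n.+1)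
    = (1 - th None) * (1 - be ^+ (n - c)).
  have -> : 1 - th None = \sum_(s | s != None) th s.
    by rewrite -th_sum1 (bigD1 None) //= addrAC subrr add0r.
  by rewrite mulr_suml; apply: eq_bigr => -[].
rewrite /potential -/n.
have bn0 : 0 <= be ^+ n by rewrite exprn_ge0 ?(ltW be_gt0).
have bn1 : 0 <= be ^+ n.+1 by rewrite exprn_ge0 ?(ltW be_gt0).
have tn := th_ge0 None.
case: c => /=; last by rewrite subn0; nra.
by rewrite subn1; nra.
Qed.

(** Each site of the system is rung by exactly one driving site. *)
Lemma sum_loc (u : S -> R) :
  \sum_j (if loc j is Some e then u e else 0) = \sum_e u e.
Proof.
rewrite (bigID (fun j => isSome (loc j))) /= [X in _ + X]big1 ?addr0; last first.
  by move=> j; case: (loc j).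
rewrite (reindex_omap emb loc) /=; last first.
  by move=> j; case E: (loc j) => [e|] //= _; have := locK j; rewrite E /= => ->.
rewrite (eq_bigl predT) ?big_mkcond /=; last by move=> e; rewrite embK eqxx.
by apply: eq_bigr => e _; rewrite embK.
Qed.

(** Summing [potential_site] over the sites gains
    [n (1 - th None) be^(n-1)] from the [n] disagreements and loses at most
    [#|S| be^n], which is at most half of that by the choice of the base. *)
Lemma potential_step x y :
  \sum_i clock th i * potential (driven r loc x i) (driven r loc y i)
    <= (1 - ka / #|J|%:R) * potential x y.
Proof.
have [<-|xy] := eqVneq x y.
  by rewrite potential_xx mulr0 big1 // => i _; rewrite potential_xx mulr0.
have /andP[g0 g1] := th_free_ge0.
have Jp : 0 < #|J|%:R :> R by rewrite ltr0n.
rewrite clock_sum; set n := #|disagreement x y|.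
have n_gt0 : (0 < n)%N by exact: disagreement_gt0.
pose u e := be ^+ n - (e \in disagreement x y)%:R * (1 - th None) * be ^+ n.-1.
apply: (@le_trans _ _ (#|J|%:R^-1 *
   \sum_j (potential x y + (if loc j is Some e then u e else 0)))).
  rewrite ler_wpM2l ?invr_ge0 ?ler0n //; apply: ler_sum => j _.
  rewrite /driven /=; case: (loc j) => [e|]; first exact: potential_site.
  by rewrite -mulr_suml th_sum1 mul1r addr0.
rewrite big_split /= sumr_const sum_loc -[potential x y *+ _]mulr_natl.
rewrite mulrDr mulrA mulVf ?gt_eqF // mul1r mulrBl mul1r lerD2l.
have -> : - (ka / #|J|%:R * potential x y) = #|J|%:R^-1 * - (potential x y * ka).
  by ring.
rewrite ler_wpM2l ?invr_ge0 ?ler0n //.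
rewrite sumrB sumr_const.
have -> : \sum_e (e \in disagreement x y)%:R * (1 - th None) * be ^+ n.-1
    = n%:R * (1 - th None) * be ^+ n.-1.
  rewrite -!mulr_suml -natr_sum; congr (_%:R * _ * _).
  rewrite /n -sum1_card [RHS]big_mkcond /=.
  by apply: eq_bigr => e _; case: (e \in _).
have bM : #|S|%:R * be <= (1 - th None) / 2 by exact: base_mul.
have b1 : be ^+ #|S| <= be ^+ n.-1.
  have le_nS : (n.-1 <= #|S|)%N.
    by rewrite (leq_trans (leq_pred _)) // max_card.
  rewrite -(subnK le_nS) exprD ler_piMl ?exprn_ge0 ?exprn_ile1 ?(ltW be_gt0) //.
have b0 : 0 < be ^+ #|S| by rewrite exprn_gt0.
have -> : be ^+ n *+ #|S| = #|S|%:R * be * be ^+ n.-1.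
  by rewrite -mulrA -exprS prednK // mulr_natl.
have n1 : 1 <= n%:R :> R by rewrite ler1n.
have P1 := potential_le1 x y; have P0 := potential_ge0 x y.
set c := be ^+ n.-1 in b1 *; set m := be ^+ #|S| in b1 b0.
have kaE : ka = m * ((1 - th None) / 2) by [].
rewrite kaE.
have h1 : #|S|%:R * be * c <= (1 - th None) / 2 * c by rewrite ler_wpM2r //; lra.
have h2 : (1 - th None) * c <= n%:R * (1 - th None) * c.
  by rewrite -mulrA ler_peMl //; apply: mulr_ge0 => //; lra.
have h3 : potential x y * (m * ((1 - th None) / 2)) <= c * ((1 - th None) / 2).
  apply: (@le_trans _ _ (m * ((1 - th None) / 2))).
    by rewrite ler_piMl //; apply: mulr_ge0; lra.
  by rewrite ler_wpM2r //; lra.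
lra.
Qed.

Lemma potential_decay k x y :
  wordE (clock th (J:=J)) k (fun w => potential (run r loc x w) (run r loc y w))
    <= (1 - ka / #|J|%:R) ^+ k * potential x y.
Proof.
have th0 : 0 <= 1 - ka / #|J|%:R.
  rewrite subr_ge0 ler_pdivrMr ?ltr0n // mul1r.
  by rewrite (le_trans (coalescence_rate_le1 _)) // ler1n.
elim: k x y => [|k IH] x y; first by rewrite expr0 mul1r.
rewrite exprSr -mulrA.
apply: le_trans (ler_wpM2l (exprn_ge0 k th0) (potential_step x y)).
rewrite mulr_sumr /=; apply: ler_sum => i _.
by rewrite mulrCA ler_wpM2l ?clock_ge0.
Qed.

(** The rate per ring of the system depends only on its number of sites, not
    on the number of driving sites: this uniformity is used for a fixed box in
    arbitrarily large tori. *)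
Lemma trans_contraction k f x y : (forall z, 0 <= f z <= 1) ->
  trans th r loc k f x - trans th r loc k f y
    <= 2 * expR (- (ka / #|J|%:R * k%:R)).
Proof.
move=> f01; rewrite /trans -wordEB.
have th0 : 0 <= 1 - ka / #|J|%:R.
  rewrite subr_ge0 ler_pdivrMr ?ltr0n // mul1r.
  by rewrite (le_trans (coalescence_rate_le1 _)) // ler1n.
apply: (@le_trans _ _ (wordE (clock th (J:=J)) k
    (fun w => 2 * potential (run r loc x w) (run r loc y w)))).
  apply: ler_wordE => [i|w]; first exact: clock_ge0.
  have [->|/potential_half ph] := eqVneq (run r loc x w) (run r loc y w).
    by rewrite subrr mulr_ge0 ?potential_ge0.
  have /andP[_ a1] := f01 (run r loc x w).
  by have /andP[b0 _] := f01 (run r loc y w); lra.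
rewrite wordEZ ler_wpM2l // (le_trans (potential_decay _ _ _)) //.
apply: (@le_trans _ _ ((1 - ka / #|J|%:R) ^+ k)).
  by rewrite ler_piMr ?exprn_ge0 ?potential_le1.
rewrite -[X in expR X]mulNr [X in expR X]mulrC expRM_natl.
rewrite lerXn2r ?nnegrE ?expR_ge0 //.
exact: expR_ge1Dx.
Qed.

Lemma trans_near_invariant (pi : {set S} -> R) k f x :
  (forall z, 0 <= pi z) -> \sum_z pi z = 1 -> invariant_law th r pi ->
  (forall z, 0 <= f z <= 1) ->
  `|trans th r loc k f x - \sum_z pi z * f z|
    <= 2 * expR (- (ka / #|J|%:R * k%:R)).
Proof.
move=> pi0 pi1 inv f01; rewrite -(trans_invariant th_sum1 J_gt0 loc k f inv).
have E c : c = \sum_z pi z * c by rewrite -mulr_suml pi1 mul1r.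
rewrite [trans _ _ _ _ _ x]E -sumrB.
apply: (le_trans (ler_norm_sum _ _ _)).
rewrite [leRHS]E; apply: ler_sum => z _.
rewrite -mulrBr normrM ger0_norm // ler_wpM2l // ler_norml.
have c1 := trans_contraction k x z f01; have c2 := trans_contraction k z x f01.
by rewrite lerNl opprB c1 c2.
Qed.

End Coalescence.

(** * Comparison of a system with a box inside it *)

Section BoxComparison.
Variables (R : realType) (th : option bool -> R).
Hypotheses (th_ge0 : forall s, 0 <= th s) (th_sum1 : \sum_s th s = 1).
Hypothesis th_free : th None < 1.
Variables (S B : finType) (loc : S -> option B) (emb : B -> S).
Hypotheses (S_gt0 : (0 < #|S|)%N) (embK : pcancel emb loc)
  (locK : ocancel loc emb).
Variables (r : {set S} -> S -> bool) (r1 r0 : {set B} -> B -> bool).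
Hypotheses (mono_r : monotone_rule r) (mono_r1 : monotone_rule r1)
  (mono_r0 : monotone_rule r0).

Definition restriction (x : {set S}) : {set B} := [set e | emb e \in x].

Hypothesis rule_up : forall x e, r x (emb e) -> r1 (restriction x) e.
Hypothesis rule_down : forall x e, r0 (restriction x) e -> r x (emb e).

Lemma in_driven_full x (j : S) s e :
  (emb e \in driven r Some x (j, s)) =
    if loc j == Some e then (if s is Some b then b else r x (emb e))
    else emb e \in x.
Proof.
rewrite /driven /heat in_force /=.
have -> : (emb e == j) = (loc j == Some e).
  apply/eqP/eqP => [<-|E]; first exact: embK.
  by have := locK j; rewrite E.
by case: eqP => // E; have := locK j; rewrite E /= => ->.
Qed.

Lemma in_driven_box (rB : {set B} -> B -> bool) y (j : S) s e :
  (e \in driven rB loc y (j, s)) =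
    if loc j == Some e then (if s is Some b then b else rB y e) else e \in y.
Proof.
rewrite /driven /=; case E: (loc j) => [e'|] //=.
rewrite /heat in_force eq_sym; have -> : (Some e' == Some e) = (e' == e) by [].
by case: eqP => // ->.
Qed.

(** The hypothesis [rule_up] says that the box rule is at least as favourable
    to opening as the ambient one; monotonicity propagates this along the word. *)
Lemma restrict_run_up x (y : {set B}) w : restriction x \subset y ->
  restriction (run r Some x w) \subset run r1 loc y w.
Proof.
elim: w x y => [//|[j s] w IH] x y xy; apply: IH; apply/subsetP => e.
rewrite inE in_driven_full in_driven_box; case: eqP => _; last first.
  by move=> ex; apply: (subsetP xy); rewrite inE.
by case: s => // /rule_up; exact: mono_r1.
Qed.

Lemma restrict_run_down x (y : {set B}) w : y \subset restriction x ->
  run r0 loc y w \subset restriction (run r Some x w).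
Proof.
elim: w x y => [//|[j s] w IH] x y yx; apply: IH; apply/subsetP => e.
rewrite inE in_driven_full in_driven_box; case: eqP => _; last first.
  by move=> /(subsetP yx); rewrite inE.
by case: s => // /(mono_r0 yx) /rule_down.
Qed.

Lemma trans_restrict_up k g x : increasing g ->
  trans th r Some k (g \o restriction) x <= trans th r1 loc k g (restriction x).
Proof.
move=> Ig; apply: ler_wordE => [i|w /=]; first exact: clock_ge0.
by apply: Ig; exact: restrict_run_up.
Qed.

Lemma trans_restrict_down k g x : increasing g ->
  trans th r0 loc k g (restriction x) <= trans th r Some k (g \o restriction) x.
Proof.
move=> Ig; apply: ler_wordE => [i|w /=]; first exact: clock_ge0.
by apply: Ig; exact: restrict_run_down.
Qed.

Variables (pi : {set S} -> R) (pi1 pi0 : {set B} -> R).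
Hypotheses (pi_ge0 : forall x, 0 <= pi x) (pi_sum1 : \sum_x pi x = 1)
  (pi_inv : invariant_law th r pi).
Hypotheses (pi1_ge0 : forall x, 0 <= pi1 x) (pi1_sum1 : \sum_x pi1 x = 1)
  (pi1_inv : invariant_law th r1 pi1).
Hypotheses (pi0_ge0 : forall x, 0 <= pi0 x) (pi0_sum1 : \sum_x pi0 x = 1)
  (pi0_inv : invariant_law th r0 pi0).

Let rate : R := coalescence_rate th #|B|.

Lemma small_mixing_error e : 0 < e ->
  exists k : nat, 2 * expR (- (rate / #|S|%:R * k%:R)) <= e.
Proof.
move=> e0; have rS : 0 < rate / #|S|%:R.
  by rewrite divr_gt0 ?coalescence_rate_gt0 ?ltr0n.
have [|k hk] := @expR_small R (rate / #|S|%:R) (e / 2) rS; first by lra.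
by exists k; lra.
Qed.

(** Stochastic domination obtained dynamically: run the ambient chain from
    its invariant law and the box chain from its restriction, and let time go to
    infinity. *)
Lemma law_restrict_le g : increasing g -> (forall z, 0 <= g z <= 1) ->
  \sum_x pi x * g (restriction x) <= \sum_y pi1 y * g y.
Proof.
move=> Ig g01; apply/ler_addgt0Pr => e e0; have [k hk] := small_mixing_error e0.
rewrite -(trans_invariant th_sum1 S_gt0 Some k (g \o restriction) pi_inv).
have E c : c = \sum_z pi z * c by rewrite -mulr_suml pi_sum1 mul1r.
rewrite [leRHS]E; apply: ler_sum => x _; rewrite ler_wpM2l //.
apply: le_trans (trans_restrict_up _ _ Ig) _; rewrite -lerBlDl.
apply: le_trans hk; apply: le_trans (ler_norm _) _.
exact: trans_near_invariant.
Qed.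

Lemma law_restrict_ge g : increasing g -> (forall z, 0 <= g z <= 1) ->
  \sum_y pi0 y * g y <= \sum_x pi x * g (restriction x).
Proof.
move=> Ig g01; apply/ler_addgt0Pr => e e0; have [k hk] := small_mixing_error e0.
rewrite -(trans_invariant th_sum1 S_gt0 Some k (g \o restriction) pi_inv) -lerBlDr.
have E c : c = \sum_z pi z * c by rewrite -mulr_suml pi_sum1 mul1r.
rewrite [leLHS]E; apply: ler_sum => x _; rewrite ler_wpM2l //.
apply: le_trans (trans_restrict_down _ _ Ig); rewrite lerBlDr addrC -lerBlDr.
apply: le_trans hk; apply: le_trans (ler_norm _) _; rewrite distrC.
exact: trans_near_invariant.
Qed.

Lemma open_at01 (T : finType) (e : T) (x : {set T}) : 0 <= open_at R e x <= 1.
Proof. by rewrite /open_at; case: (e \in x); rewrite lexx ler01. Qed.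

Lemma open_at_increasing (T : finType) (e : T) : increasing (open_at R e).
Proof. exact: open_at_le. Qed.

Lemma open_at_restrict e : open_at R e \o restriction = open_at R (emb e).
Proof. by apply: funext => x; rewrite /open_at /= inE. Qed.

(** At time [k] the ambient gap is bounded by the difference between the box
    chains started from the top and from the bottom, each of which is close to
    its invariant law. *)
Lemma gap_small_time k e :
  gap th r Some k (emb e)
    <= \sum_y pi1 y * open_at R e y - \sum_y pi0 y * open_at R e y
       + 4 * expR (- (rate / #|S|%:R * k%:R)).
Proof.
rewrite /gap -open_at_restrict.
have u := trans_restrict_up k [set: S] (@open_at_increasing _ e).
have d := trans_restrict_down k set0 (@open_at_increasing _ e).
have u' := trans_near_invariant th_ge0 th_sum1 th_free S_gt0 embK locK k
  (restriction [set: S]) pi1_ge0 pi1_sum1 pi1_inv (@open_at01 _ e).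
have d' := trans_near_invariant th_ge0 th_sum1 th_free S_gt0 embK locK k
  (restriction set0) pi0_ge0 pi0_sum1 pi0_inv (@open_at01 _ e).
move: u' d'; rewrite !ler_norml -/rate => /andP[_ u'] /andP[d' _]; lra.
Qed.

(** The quadratic recursion.  Three ambient chains are run for time [k], from
    the bottom, from the invariant law and from the top; [pointwise] bounds what
    the following [k] steps can make of their positions [c], [y] and [a]. *)
Lemma gap_doubling k (b : R) e : (forall j, gap th r Some k j <= b) ->
  gap th r Some (k + k) (emb e)
    <= #|B|%:R * b ^+ 2
       + (\sum_y pi1 y * open_at R e y - \sum_y pi0 y * open_at R e y).
Proof.
move=> gap_b.
set h := trans th r Some k (open_at R (emb e)).
set h1 := trans th r1 loc k (open_at R e).
set h0 := trans th r0 loc k (open_at R e).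
have Ih : increasing h.
  by apply: trans_increasing => //; exact: open_at_increasing.
have Ih1 : increasing h1.
  by apply: trans_increasing => //; exact: open_at_increasing.
have Ih0 : increasing h0.
  by apply: trans_increasing => //; exact: open_at_increasing.
have hb x y : h x - h y <= b.
  apply: le_trans (gap_b (emb e)); rewrite /gap -/h.
  by apply: lerB; apply: Ih; rewrite ?subsetT ?sub0set.
have h_le x : h x <= h1 (restriction x).
  by rewrite /h -open_at_restrict trans_restrict_up //; exact: open_at_increasing.
have h_ge x : h0 (restriction x) <= h x.
  by rewrite /h -open_at_restrict trans_restrict_down //; exact: open_at_increasing.
have b0 : 0 <= b by have := hb [set: S] [set: S]; rewrite subrr.
(* [a], [y], [c] are the positions at time [k] of the chains from the top, from
   the invariant law and from the bottom. *)
have pointwise (a y c : {set S}) : c \subset y -> y \subset a ->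
  h a - h c <= b * \sum_g (open_at R (emb g) a - open_at R (emb g) c)
               + (h1 (restriction y) - h0 (restriction y)).
  move=> cy ya; have ca := subset_trans cy ya.
  have ge0 g : 0 <= open_at R (emb g) a - open_at R (emb g) c.
    by rewrite subr_ge0 open_at_le.
  have [ac|/subsetPn[g]] := boolP (restriction a \subset restriction c).
    rewrite -[leLHS]add0r lerD //; first by rewrite mulr_ge0 ?sumr_ge0.
    rewrite lerB //.
      apply: le_trans (h_le a) _; apply: Ih1; apply: subset_trans ac _.
      by apply/subsetP => g; rewrite !inE; exact: (subsetP cy).
    apply: le_trans (h_ge c); apply: Ih0; apply: subset_trans ac.
    by apply/subsetP => g; rewrite !inE; exact: (subsetP ya).
  rewrite !inE => ga gc; rewrite -[leLHS]addr0 lerD //; last first.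
    by rewrite subr_ge0 (le_trans (h_ge y)).
  apply: le_trans (hb a c) _; rewrite -[leLHS]mulr1 ler_wpM2l //.
  rewrite (bigD1 g) //= /open_at ga (negPf gc) subr0 lerDl sumr_ge0 // => g' _.
  exact: ge0.
(* The same words of length [k] drive the three chains, so that the previous
   inequality holds word by word. *)
have step y : gap th r Some (k + k) (emb e) <=
    b * \sum_g gap th r Some k (emb g)
    + (trans th r Some k (h1 \o restriction) y
       - trans th r Some k (h0 \o restriction) y).
  rewrite /gap !trans_add -/h /trans.
  under eq_bigr do rewrite -wordEB.
  rewrite -wordE_sum -!wordEB -wordEZ -wordED.
  apply: ler_wordE => [i|w]; first exact: clock_ge0.
  by apply: pointwise; apply: run_sub => //; rewrite ?sub0set ?subsetT.
(* Averaging the initial state of the middle chain over the invariant law. *)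
have avg : gap th r Some (k + k) (emb e) <=
    b * \sum_g gap th r Some k (emb g)
    + (\sum_y pi1 y * h1 y - \sum_y pi0 y * h0 y).
  apply: (@le_trans _ _ (\sum_y pi y * (b * \sum_g gap th r Some k (emb g)
    + (trans th r Some k (h1 \o restriction) y
       - trans th r Some k (h0 \o restriction) y)))).
    have E c : c = \sum_z pi z * c by rewrite -mulr_suml pi_sum1 mul1r.
    by rewrite [leLHS]E; apply: ler_sum => y _; rewrite ler_wpM2l.
  under eq_bigr do rewrite mulrDr mulrBr.
  rewrite big_split /= -mulr_suml pi_sum1 mul1r lerD2l sumrB.
  rewrite !(trans_invariant th_sum1 S_gt0 Some k _ pi_inv) lerB //.
    apply: law_restrict_le => // z; apply: trans_bound => // z'.
    exact: open_at01.
  apply: law_restrict_ge => // z; apply: trans_bound => // z'.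
  exact: open_at01.
apply: le_trans avg _; rewrite /h1 /h0 (trans_invariant th_sum1 S_gt0 loc k _ pi1_inv).
rewrite (trans_invariant th_sum1 S_gt0 loc k _ pi0_inv) lerD2r.
rewrite expr2 mulrCA ler_wpM2l // mulr_natl -sumr_const.
by apply: ler_sum => g _.
Qed.

End BoxComparison.

(** Union bound: if the chains from [x] and [y] differ, then the extreme chains
    differ at some site. *)
Lemma trans_gap (R : realType) (th : option bool -> R) (S J : finType)
    (r : {set S} -> S -> bool) (loc : J -> option S) k f x y :
  (forall s, 0 <= th s) -> monotone_rule r -> (forall z, 0 <= f z <= 1) ->
  trans th r loc k f x - trans th r loc k f y <= \sum_e gap th r loc k e.
Proof.
move=> th0 mr f01; rewrite /gap /trans.
under [leRHS]eq_bigr do rewrite -wordEB.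
rewrite -wordE_sum -wordEB; apply: ler_wordE => [i|w]; first exact: clock_ge0.
set a := run _ _ [set: S] w; set b := run _ _ set0 w.
have sub z : b \subset run r loc z w /\ run r loc z w \subset a.
  by split; apply: run_sub; rewrite ?sub0set ?subsetT.
have [[bx xa] [by_ ya]] := (sub x, sub y); have ba := subset_trans bx xa.
have ge0 g : 0 <= open_at R g a - open_at R g b by rewrite subr_ge0 open_at_le.
have [ab|/subsetPn[g ga gb]] := boolP (a \subset b).
  have -> : run r loc x w = run r loc y w.
    have E z : run r loc z w = b.
      by apply/eqP; rewrite eqEsubset (sub z).1 (subset_trans (sub z).2 ab).
    by rewrite !E.
  by rewrite subrr sumr_ge0.
rewrite (bigD1 g) //= {1}/open_at ga {1}/open_at (negPf gb) subr0.
apply: (@le_trans _ _ 1); last by rewrite lerDl sumr_ge0.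
have /andP[_ h1] := f01 (run r loc x w).
have /andP[h2 _] := f01 (run r loc y w); lra.
Qed.

(** * The random-cluster model as single-site dynamics *)

Section AddEdge.
Variables (V : finType) (r r' : rel V) (x y : V).
Hypotheses (sym_r : symmetric r)
  (r'E : forall u v, r' u v = r u v || ([set u; v] == [set x; y])).

Let sym_r' : symmetric r'.
Proof. by move=> u v; rewrite !r'E sym_r setUC. Qed.

Let sub_rr' : subrel (connect r) (connect r').
Proof. by apply: connect_sub => u v ruv; rewrite connect1 // r'E ruv. Qed.

Lemma set2_eq (u v : V) : [set u; v] = [set x; y] ->
  (u = x /\ v = y) \/ (u = y /\ v = x).
Proof.
move=> E; have : u \in [set x; y] by rewrite -E !inE eqxx.
have : v \in [set x; y] by rewrite -E !inE eqxx orbT.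
have : x \in [set u; v] by rewrite E !inE eqxx.
have : y \in [set u; v] by rewrite E !inE eqxx orbT.
rewrite !inE => hy hx hv /orP[]/eqP uE; rewrite {}uE in hx hy *; [left|right].
  by case/orP: hv hy => /eqP-> //; rewrite orbb => /eqP->.
by case/orP: hv hx => /eqP-> //; rewrite orbb => /eqP->.
Qed.

Lemma connect_add_redundant : connect r x y -> connect r' =2 connect r.
Proof.
move=> rxy u v; apply/idP/idP; last exact: sub_rr'.
apply: connect_sub => {}u {}v; rewrite r'E => /orP[|/eqP/set2_eq]; first exact: connect1.
by case=> -[-> ->] //; rewrite (sym_connect_sym sym_r).
Qed.

(** The union [a] of the components of the two ends is closed for both
    relations, and outside it they have the same components; inside it there are
    two components before the edge is added, and one afterwards. *)
Lemma n_comp_add_edge :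
  n_comp r predT = (n_comp r' predT + ~~ connect r x y)%N.
Proof.
have csr := sym_connect_sym sym_r; have csr' := sym_connect_sym sym_r'.
have [cxy|ncxy] := boolP (connect r x y).
  by rewrite addn0; apply/esym/eq_n_comp/connect_add_redundant.
pose a := closure_mem r (mem (pred2 x y)).
have aE u : (u \in a) = connect r x u || connect r y u.
  apply/pred0Pn/orP => [[v /andP[ruv]]|].
    rewrite /= -topredE /= in ruv *.
    by move=> /pred2P[] E; [left|right]; rewrite csr -E.
  by case=> c; [exists x|exists y]; rewrite /= -topredE /= csr c !inE eqxx ?orbT.
have a' : a =i closure_mem r' (mem (pred2 x y)).
  move=> u; rewrite aE; apply/idP/pred0Pn.
    by move=> /orP[]/sub_rr' c; [exists x|exists y];
       rewrite /= -topredE /= csr' c !inE eqxx ?orbT.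
  case=> v /andP[ruv] vxy; rewrite /= -topredE /= in ruv.
  have va : v \in a by rewrite aE; move: vxy; rewrite !inE => /orP[]/eqP->;
    rewrite connect0 ?orbT.
  rewrite csr' in ruv; rewrite -aE; case/connectP: ruv => s.
  elim: s v va {vxy} => [|w s IH] v va /=; first by move=> _ ->.
  case/andP=> rvw; apply: IH; move: rvw; rewrite r'E => /orP[rvw|/eqP/set2_eq].
    by rewrite -(fingraph.closure_closed csr (pred2 x y) rvw).
  by case=> -[_ ->]; rewrite aE connect0 ?orbT.
rewrite (n_compC a) [in RHS](n_compC a) /= addn1 -addSn; congr (_ + _)%N.
  rewrite (n_comp_closure2 csr) ncxy /= (eq_n_comp_r a') (n_comp_closure2 csr').
  suff -> : connect r' x y by [].
  by rewrite connect1 // r'E eqxx orbT.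
apply: eq_card => u; rewrite !inE; case: (boolP (u \in a)) => ua; rewrite ?andbF //.
rewrite !andbT /roots; congr (_ == _); rewrite /root; congr odflt.
apply: eq_pick => v; apply/idP/idP; first exact: sub_rr'.
case/connectP => s; elim: s u ua => [|w s IH] u ua /=; first by move=> _ ->.
case/andP => ruw; have {}ruw : r u w.
  move: ruw; rewrite r'E => /orP[//|/eqP/set2_eq].
  by case=> -[E _]; move: ua; rewrite aE E connect0 ?orbT.
move=> sp lv; apply: connect_trans (connect1 ruw) (IH w _ sp lv).
by rewrite -(fingraph.closure_closed csr (pred2 x y) ruw).
Qed.

End AddEdge.

Section RandomClusterSites.
Variables (R : realType) (p q : R).
Hypotheses (hq : 1 <= q) (hp0 : 0 <= p) (hp1 : p <= 1).

(** [Some b] forces the edge to the state [b]; [None] lets the cycle rule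
    decide.  The three weights realise both conditional opening probabilities
    with a single coin. *)
Definition coin (s : option bool) : R :=
  match s with
  | Some true => p / (q * (1 - p) + p)
  | Some false => 1 - p
  | None => p - p / (q * (1 - p) + p)
  end.

Lemma coin_den_ge1 : 1 <= q * (1 - p) + p.
Proof.
have : 0 <= (q - 1) * (1 - p) by rewrite mulr_ge0 ?subr_ge0.
by lra.
Qed.

Lemma coin_ge0 s : 0 <= coin s.
Proof.
have d1 := coin_den_ge1; case: s => [[]|] /=.
- by rewrite divr_ge0 //; lra.
- by rewrite subr_ge0.
by rewrite subr_ge0 ler_pdivrMr ?ler_peMr //; lra.
Qed.

Lemma sum_coin (F : option bool -> R) : \sum_s coin s * F s =
  coin None * F None + (coin (Some true) * F (Some true)
                        + coin (Some false) * F (Some false)).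
Proof.
by rewrite (bigD1 None) // (bigD1 (Some true)) // (bigD1 (Some false)) //=
  big1 ?addr0 // => -[[]|].
Qed.

Lemma coin_sum1 : \sum_s coin s = 1.
Proof.
by under eq_bigr do rewrite -[coin _]mulr1; rewrite sum_coin /=; lra.
Qed.

(** A forced update has positive probability for every [p], including 0 and 1,
    so that coalescence needs no separate treatment of these degenerate cases. *)
Lemma coin_free : coin None < 1.
Proof.
have d1 := coin_den_ge1; rewrite /coin.
have [->|p1] := eqVneq p 1; first by rewrite subrr mulr0 add0r divr1; lra.
have : 0 <= p / (q * (1 - p) + p) by rewrite divr_ge0 //; lra.
by move: hp1; rewrite le_eqVlt (negPf p1) /=; lra.
Qed.

Variables (V : finType) (adj : rel V).
Local Notation E := (edge adj).
Implicit Types (xi : {set {set V}}) (w : {set E}) (e : E).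

Lemma linked_sym xi w : symmetric (linked xi w).
Proof.
move=> x y; rewrite /linked setUC.
by under [X in _ || X]eq_existsb do rewrite [X in _ && X]andbC.
Qed.

Lemma linked_mono xi w w' : w \subset w' -> subrel (linked xi w) (linked xi w').
Proof.
move=> ww' x y /orP[/existsP[e /andP[ew exy]]|h]; apply/orP; [left|by right].
by apply/existsP; exists e; rewrite (subsetP ww').
Qed.

Lemma connect_linked_mono xi w w' : w \subset w' ->
  subrel (connect (linked xi w)) (connect (linked xi w')).
Proof. by move=> ww'; apply: connect_sub => x y /(linked_mono ww')/connect1. Qed.

Lemma edge_ends e : exists x y, adj x y /\ val e = [set x; y].
Proof. by case: e => s /= /imsetP[[x y]]; rewrite inE /= => axy ->; exists x, y. Qed.

Lemma linked_add xi w e x y : val e = [set x; y] -> forall u v,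
  linked xi (e |: w) u v = linked xi (w :\ e) u v || ([set u; v] == [set x; y]).
Proof.
move=> exy u v; rewrite /linked orbAC; congr (_ || _).
apply/existsP/orP => [[g /andP[]]|[/existsP[g /andP[]]|/eqP E]].
- rewrite !inE; have [-> _|ge /= gw] := eqVneq g e.
    by rewrite exy eq_sym => /eqP->; right.
  by move=> guv; left; apply/existsP; exists g; rewrite !inE ge gw.
- by rewrite !inE => /andP[_ gw] guv; exists g; rewrite !inE gw orbT.
by exists e; rewrite !inE eqxx /= exy E.
Qed.

Lemma ncomp_add xi w e x y : val e = [set x; y] ->
  ncomp xi (w :\ e) =
    (ncomp xi (e |: w) + ~~ connect (linked xi (w :\ e)) x y)%N.
Proof.
move=> exy; apply: n_comp_add_edge; first exact: linked_sym.
exact: linked_add.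
Qed.

Lemma is_bridgeE xi w e x y : val e = [set x; y] ->
  is_bridge xi w e = ~~ connect (linked xi (w :\ e)) x y.
Proof.
move=> exy; rewrite /is_bridge (ncomp_add xi w exy).
by case: connect => /=; rewrite ?addn0 ?eqxx // addn1 neq_ltn leqnn orbT.
Qed.

Definition cycle_rule xi w e := ~~ is_bridge xi w e.

Lemma cycle_rule_mono xi : monotone_rule (cycle_rule xi).
Proof.
move=> w w' e ww'; have [x [y [_ exy]]] := edge_ends e.
rewrite /cycle_rule !(is_bridgeE _ _ exy) !negbK.
by apply: connect_linked_mono; apply: setSD.
Qed.

Lemma sum_coin_heat xi e (f : {set E} -> R) w :
  \sum_s coin s * f (heat (cycle_rule xi) e s w) =
    open_prob p q xi w e * f (e |: w) + (1 - open_prob p q xi w e) * f (w :\ e).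
Proof.
rewrite sum_coin /heat /force /cycle_rule /open_prob /=.
by case: is_bridge => /=; ring.
Qed.

Lemma sum_site e (F : {set E} -> R) :
  \sum_w F w = \sum_(w : {set E} | e \notin w) (F w + F (e |: w)).
Proof.
rewrite (bigID (fun w : {set E} => e \notin w)) /= big_split /=; congr (_ + _).
rewrite (reindex_onto (fun w => e |: w) (fun w => w :\ e)) /=; last first.
  by move=> w; rewrite negbK => ew; rewrite setD1K.
apply: eq_bigl => w; rewrite negbK !inE eqxx /=.
apply/eqP/idP => [<-|ew]; last exact: setU1K.
by rewrite !inE eqxx.
Qed.

Lemma fk_weight_ge0 xi w : 0 <= fk_weight p q xi w.
Proof.
rewrite /fk_weight; do !apply: mulr_ge0; apply: exprn_ge0; rewrite ?subr_ge0 //.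
exact: le_trans ler01 hq.
Qed.

(** The heat-bath property: the opening probability is the conditional
    probability of the edge being open given all other edges. *)
Lemma fk_weight_open xi w e : e \notin w ->
  fk_weight p q xi (e |: w) = open_prob p q xi w e
    * (fk_weight p q xi w + fk_weight p q xi (e |: w)).
Proof.
move=> ew; have [x [y [_ exy]]] := edge_ends e; have d1 := coin_den_ge1.
have wD : w :\ e = w by apply/setDidPl; rewrite disjoint_sym disjoints1.
have cE := ncomp_add xi w exy; have bE := is_bridgeE xi w exy.
rewrite /open_prob bE; rewrite wD in cE *; move: cE.
rewrite /fk_weight cardsU1 ew add1n.
have lt_w : (#|w| < #|{: E}|)%N.
  rewrite -cardsT; apply: proper_card; rewrite properE subsetT.
  by apply/subsetPn; exists e; rewrite ?inE.
rewrite -(subnSK lt_w).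
have d0 : q * (1 - p) + p != 0 by rewrite gt_eqF // (lt_le_trans ltr01).
case: connect => /= ->; rewrite ?addn0 ?addn1 !exprS;
  move: (p ^+ _) ((1 - p) ^+ _) (q ^+ _) => a b c; first by ring.
by field.
Qed.

Lemma fk_weight_invariant xi : invariant_law coin (cycle_rule xi) (fk_weight p q xi).
Proof.
move=> e f; under eq_bigr do rewrite sum_coin_heat.
rewrite !(sum_site e); apply: eq_bigr => w ew.
have [x [y [_ exy]]] := edge_ends e.
have wD : w :\ e = w by apply/setDidPl; rewrite disjoint_sym disjoints1.
have UD : (e |: w) :\ e = w by rewrite setU1K.
have UU : e |: (e |: w) = e |: w by rewrite setUA setUid.
have oE : open_prob p q xi (e |: w) e = open_prob p q xi w e.
  by rewrite /open_prob !(is_bridgeE _ _ exy) UD wD.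
rewrite oE UD UU wD; have := fk_weight_open xi ew.
set A := fk_weight p q xi (e |: w); set B := fk_weight p q xi w.
set o := open_prob _ _ _ _ _ => AE.
transitivity ((o * (B + A)) * f (e |: w) + ((B + A) - o * (B + A)) * f w).
  by ring.
by rewrite -AE; ring.
Qed.

Lemma fk_partition_gt0 xi : 0 < \sum_(w : {set E}) fk_weight p q xi w.
Proof.
have q0 : 0 < q := lt_le_trans ltr01 hq.
have [w w0] : exists w : {set E}, 0 < fk_weight p q xi w.
  have [pE|p1] := eqVneq p 1.
    exists [set: E]; rewrite /fk_weight cardsT subnn expr0 mulr1 pE expr1n mul1r.
    exact: exprn_gt0.
  exists set0; rewrite /fk_weight cards0 expr0 mul1r mulr_gt0 ?exprn_gt0 //.
  by move: hp1; rewrite le_eqVlt (negPf p1) /=; lra.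
rewrite (bigD1 w) //= ltr_pwDl // sumr_ge0 // => w' _; exact: fk_weight_ge0.
Qed.

Lemma fk_measure_ge0 xi w : 0 <= fk_measure p q xi w.
Proof. by rewrite divr_ge0 ?fk_weight_ge0 // ltW ?fk_partition_gt0. Qed.

Lemma fk_measure_sum1 xi : \sum_w fk_measure p q (adj := adj) xi w = 1.
Proof. by rewrite -mulr_suml mulfV // gt_eqF ?fk_partition_gt0. Qed.

Lemma fk_measure_invariant xi :
  invariant_law coin (cycle_rule xi) (fk_measure p q xi).
Proof.
move=> e f; rewrite /fk_measure.
under eq_bigr do rewrite mulrAC; under [RHS]eq_bigr do rewrite mulrAC.
by rewrite -!mulr_suml fk_weight_invariant.
Qed.

(** The chain appends its last step on the right, while [trans] conditions on
    the first letter; [trans_add] reconciles the two. *)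
Lemma law_after_trans xi k w (f : {set E} -> R) :
  \sum_w' law_after (fk_kernel p q xi) k w w' * f w' =
    trans coin (cycle_rule xi) Some k f w.
Proof.
elim: k f => [|k IH] f /=.
  rewrite (bigD1 w) //= eqxx mul1r big1 ?addr0 // => w' /negPf->.
  by rewrite mul0r.
rewrite -addn1 trans_add -IH.
under eq_bigr do rewrite mulr_suml; rewrite exchange_big /=.
apply: eq_bigr => v _; under eq_bigr do rewrite -mulrA; rewrite -mulr_sumr.
congr (_ * _); rewrite /trans /= clock_sum /fk_kernel.
under eq_bigr do rewrite -mulrA; rewrite -mulr_sumr; congr (_ * _).
under eq_bigr do rewrite mulr_suml; rewrite exchange_big /=.
apply: eq_bigr => e _; rewrite /driven /= sum_coin_heat.
rewrite /fk_update; under eq_bigr do rewrite mulrDl -!mulrA.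
rewrite big_split /= -!mulr_sumr; congr (_ * _ + _ * _).
  rewrite (bigD1 (e |: v)) //= eqxx mul1r big1 ?addr0 // => w' /negPf->.
  by rewrite mul0r.
rewrite (bigD1 (v :\ e)) //= eqxx mul1r big1 ?addr0 // => w' /negPf->.
by rewrite mul0r.
Qed.

End RandomClusterSites.

(** * Wired and free boxes bound the ambient connectivity *)

Section BoxEmbedding.
Variables (VB VT : finType) (adjB : rel VB) (adjT : rel VT) (phi : VB -> VT).
Variable bd : {set VB}.
Hypotheses (phi_inj : injective phi)
  (phi_adj : forall x y, adjB x y -> adjT (phi x) (phi y))
  (phi_bd : forall x v, x \notin bd ->
     adjT (phi x) v \/ adjT v (phi x) ->
     exists y, v = phi y /\ adjB x y).
Local Notation EB := (edge adjB).
Local Notation ET := (edge adjT).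

Lemma edge_image_subproof (e : EB) : phi @: val e \in edge_set adjT.
Proof.
have [x [y [axy ->]]] := edge_ends e.
rewrite imsetU1 imset_set1; apply/imsetP; exists (phi x, phi y) => //.
by rewrite inE; exact: phi_adj.
Qed.

Definition edge_image (e : EB) : ET := Sub (phi @: val e) (edge_image_subproof e).

Definition edge_locate (j : ET) : option EB := [pick e | edge_image e == j].

Lemma edge_image_inj : injective edge_image.
Proof. by move=> e f /(congr1 val)/(imset_inj phi_inj)/val_inj. Qed.

Lemma edge_imageK : pcancel edge_image edge_locate.
Proof.
move=> e; rewrite /edge_locate; case: pickP => [f /eqP/edge_image_inj->//|].
by move/(_ e); rewrite eqxx.
Qed.

Lemma edge_locateK : ocancel edge_locate edge_image.
Proof. by move=> j; rewrite /edge_locate; case: pickP => [e /eqP|]. Qed.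

Local Notation res := (restriction edge_image).

Lemma val_edge_image (e : EB) x y :
  val e = [set x; y] -> val (edge_image e) = [set phi x; phi y].
Proof. by move=> /= ->; rewrite imsetU1 imset_set1. Qed.

Lemma restrictD1 (w : {set ET}) e : res w :\ e = res (w :\ edge_image e).
Proof. by apply/setP => f; rewrite !inE (inj_eq edge_image_inj). Qed.

Lemma linked_no_bc (w : {set ET}) u v :
  linked set0 w u v -> exists2 e, e \in w & val e = [set u; v].
Proof.
case/orP=> [/existsP[e /andP[ew /eqP]]|/existsP[B]]; first by exists e.
by rewrite inE.
Qed.

(** A path of the ambient graph may leave the box, but only through boundary
    vertices, which the wiring identifies.  The invariant [inv] along the path
    reads: at a vertex of the box, that vertex is reached; at a vertex outside,
    every boundary vertex is reached. *)
Lemma connect_box_wired (w : {set ET}) x y :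
  connect (linked set0 w) (phi x) (phi y) ->
  connect (linked [set bd] (res w)) x y.
Proof.
set L := linked _ (res w).
have bd_bd u v : u \in bd -> v \in bd -> connect L u v.
  move=> ub vb; apply: connect1; apply/orP; right; apply/existsP; exists bd.
  by rewrite inE eqxx ub vb.
have nbd a : a \notin bd -> forall v, adjT (phi a) v \/ adjT v (phi a) ->
    exists b, v = phi b /\ adjB a b by move=> abd v; exact: phi_bd.
pose inv v := forall u, (if phi u == v then true else
  (v \notin codom phi) && (u \in bd)) -> connect L x u.
suff inv_path s v : inv v -> path (linked set0 w) v s -> inv (last v s).
  case/connectP => s ps E; have: inv (phi y).
    rewrite E; apply: inv_path ps => u; rewrite (inj_eq phi_inj).
    by case: eqP => [->|_]; rewrite ?connect0 // codom_f.
  by apply; rewrite eqxx.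
elim: s v => [//|v' s IH] v iv /= /andP[/linked_no_bc[e ew vv'] ps].
apply: IH ps; have [a [b [aab ab]]] := edge_ends e.
have avv' : adjT v v' \/ adjT v' v.
  by have := set2_eq (etrans (esym vv') ab) => -[][-> ->]; [left|right].
(* When the path arrives at a boundary vertex from outside the box or from
   another boundary vertex, the wiring makes the connection. *)
have from_bd u' : phi u' = v' -> u' \in bd ->
    (v \notin codom phi \/ exists2 u, phi u = v & u \in bd) -> connect L x u'.
  move=> u'v' u'b [vn|[u uv ub]].
    by apply: iv; case: eqP => //; rewrite vn u'b.
  by apply: connect_trans (bd_bd _ _ ub u'b); apply: iv; rewrite uv eqxx.
move=> u'; have [u'v' _|_ /= /andP[v'n u'b]] := eqVneq (phi u') v'; last first.
  have [/codomP[u uv]|vn] := boolP (v \in codom phi); last first.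
    by apply: iv; rewrite vn u'b; case: ifP.
  have ub : u \in bd.
    apply: contraT => /nbd /(_ v'); rewrite -uv => /(_ avv') [z [zE _]].
    by rewrite zE codom_f in v'n.
  by apply: connect_trans (bd_bd _ _ ub u'b); apply: iv; rewrite uv eqxx.
have [/codomP[u uv]|vn] := boolP (v \in codom phi); last first.
  apply: from_bd => //; last by left.
  apply: contraT => /nbd /(_ v); rewrite u'v'.
  case=> [|z [zE _]]; first by case: avv'; [right|left].
  by rewrite zE codom_f in vn.
have iu : connect L x u by apply: iv; rewrite uv eqxx.
have [ub|/nbd/(_ v')] := boolP (u \in bd).
  have [u'b|/nbd/(_ v)] := boolP (u' \in bd).
    exact: connect_trans (bd_bd _ _ ub u'b).
  rewrite u'v'; case=> [|z [zE az]]; first by case: avv'; [right|left].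
  apply: connect_trans iu _; apply: connect1; apply/orP; left.
  have zu : z = u by apply: phi_inj; rewrite -uv.
  have uE : [set u'; u] \in edge_set adjB.
    by apply/imsetP; exists (u', u) => //; rewrite inE -zu.
  apply/existsP; exists (Sub [set u'; u] uE : EB).
  rewrite inE /= [in X in _ == X]setUC eqxx andbT.
  suff -> : edge_image (Sub [set u'; u] uE) = e by [].
  by apply: val_inj; rewrite /= imsetU1 imset_set1 vv' u'v' uv setUC.
rewrite -uv => /(_ avv') [z [zE az]].
apply: connect_trans iu _; apply: connect1; apply/orP; left.
have zu : z = u' by apply: phi_inj; rewrite u'v'.
have uE : [set u; u'] \in edge_set adjB.
  by apply/imsetP; exists (u, u') => //; rewrite inE -zu.
apply/existsP; exists (Sub [set u; u'] uE : EB); rewrite inE /= eqxx andbT.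
suff -> : edge_image (Sub [set u; u'] uE) = e by [].
by apply: val_inj; rewrite /= imsetU1 imset_set1 vv' u'v' uv.
Qed.

(** The free boundary classes are singletons and link nothing, so a path in
    the box is a path in the ambient graph. *)
Lemma connect_box_free (w : {set ET}) x y :
  connect (linked [set [set z] | z in bd] (res w)) x y ->
  connect (linked set0 w) (phi x) (phi y).
Proof.
case/connectP => s; elim: s x => [|z s IH] x /=; first by move=> _ ->.
case/andP=> lxz ps E; apply: connect_trans (IH _ ps E).
case/orP: lxz => /existsP[].
  move=> e /andP[]; rewrite inE => ew /eqP exz; apply: connect1.
  by apply/orP; left; apply/existsP; exists (edge_image e); rewrite ew /= exz
    imsetU1 imset_set1 eqxx.
move=> B /andP[/imsetP[u _ ->]]; rewrite !inE => /andP[/eqP-> /eqP->].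
exact: connect0.
Qed.

Lemma cycle_rule_wired (w : {set ET}) e :
  cycle_rule set0 w (edge_image e) -> cycle_rule [set bd] (res w) e.
Proof.
have [x [y [_ exy]]] := edge_ends e.
rewrite /cycle_rule (is_bridgeE _ _ exy) (is_bridgeE _ _ (val_edge_image exy)).
by rewrite !negbK restrictD1; exact: connect_box_wired.
Qed.

Lemma cycle_rule_free (w : {set ET}) e :
  cycle_rule [set [set z] | z in bd] (res w) e -> cycle_rule set0 w (edge_image e).
Proof.
have [x [y [_ exy]]] := edge_ends e.
rewrite /cycle_rule (is_bridgeE _ _ exy) (is_bridgeE _ _ (val_edge_image exy)).
by rewrite !negbK restrictD1; exact: connect_box_free.
Qed.

End BoxEmbedding.

(** * Boxes in the torus *)

Section TorusGeometry.
Variables (d n : nat).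
Hypothesis n_gt0 : (0 < n)%N.
Local Notation T := (torus d n).

Definition shift (i : 'I_d) (u : T) : T :=
  [ffun k => if k == i then ordS (u k) else u k].

Lemma torus_adj_sym (u v : T) : torus_adj u v = torus_adj v u.
Proof.
apply: eq_existsb => i; rewrite orbC; congr (_ && _).
by apply: eq_forallb => j; rewrite [u j == _]eq_sym.
Qed.

Lemma torus_adjP (u v : T) :
  reflect (exists i, v = shift i u \/ u = shift i v) (torus_adj u v).
Proof.
apply: (iffP existsP) => -[i].
  case/andP=> H /forallP eqj; exists i; case/orP: H => /eqP E; [left|right];
    apply/ffunP => k; rewrite ffunE; have := eqj k; case: eqP => [->|] //= _;
    by move/eqP=> ->.
case=> ->; exists i; rewrite !ffunE eqxx eqxx ?orbT /=;
  by apply/forallP => j; apply/implyP => /negPf ji; rewrite ffunE ji.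
Qed.

Lemma torus_edge_set_sub :
  edge_set (@torus_adj d n) \subset
    [set [set iu.2; shift iu.1 iu.2] | iu : 'I_d * T].
Proof.
apply/subsetP => e /imsetP[[u v]]; rewrite inE /= => /torus_adjP[i H] ->.
case: H => ->; first by apply/imsetP; exists (i, u).
by apply/imsetP; exists (i, v) => //=; rewrite setUC.
Qed.

Lemma card_torus_edge : (#|edge (@torus_adj d n)| <= d * n ^ d)%N.
Proof.
rewrite card_sig; apply: leq_trans (subset_leq_card torus_edge_set_sub) _.
apply: leq_trans (leq_imset_card _ _) _.
by rewrite card_prod !card_ord card_ffun !card_ord.
Qed.

Lemma card_torus_edge_gt0 : (0 < d)%N -> (0 < #|edge (@torus_adj d n)|)%N.
Proof.
move=> d0; pose u : T := [ffun=> Ordinal n_gt0].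
rewrite card_sig; apply/card_gt0P; exists [set u; shift (Ordinal d0) u].
apply/imsetP; exists (u, shift (Ordinal d0) u) => //; rewrite inE.
by apply/torus_adjP; exists (Ordinal d0); left.
Qed.

Variable r : nat.
Local Notation L := (Lambda d r).
Local Notation h := (r./2).

Lemma nearest_neighborP (x y : Zd d) :
  reflect (exists i, `|x i - y i|%N = 1%N /\ forall j, j != i -> x j = y j)
          (nearest_neighbor x y).
Proof.
apply: (iffP eqP) => [S1|[i [xy1 xy0]]]; last first.
  rewrite (bigD1 i) //= xy1 big1 // => j ji.
  by rewrite xy0 // subrr.
have [i xyi] : exists i, `|x i - y i|%N != 0%N.
  apply/existsP; apply: contraT; rewrite negb_exists => /forallP H.
  by move: S1; rewrite big1 // => i _; apply/eqP; have := H i; rewrite negbK.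
exists i; move: S1; rewrite (bigD1 i) //=; set a := `|_|%N; set b := (\sum_(_ | _) _)%N.
move=> ab; have [a1 b0] : a = 1%N /\ b = 0%N by move: xyi; rewrite -/a; lia.
split=> // j ji; apply/eqP; rewrite -subr_eq0 -absz_eq0 -leqn0 -b0.
by rewrite /b (bigD1 j) //= leq_addr.
Qed.

Lemma Lambda_adjP (x y : L) :
  reflect (exists i, ((x i).+1 = y i :> nat \/ (y i).+1 = x i :> nat)
                     /\ forall j, j != i -> x j = y j) (Lambda_adj x y).
Proof.
apply: (iffP (nearest_neighborP _ _)) => -[i [xy1 xy0]]; exists i; split.
- by move: xy1; rewrite !ffunE; lia.
- by move=> j /xy0; rewrite !ffunE => /addIr[E]; apply: val_inj.
- by rewrite !ffunE; lia.
by move=> j /xy0 E; rewrite !ffunE E.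
Qed.

(** The box whose corner is put at [c]. *)
Definition place (c : T) (x : L) : T :=
  [ffun k => Ordinal (ltn_pmod (c k + x k) n_gt0)].

Lemma place_inj c : (h.*2.+1 <= n)%N -> injective (place c).
Proof.
move=> le_n x y /ffunP E; apply/ffunP => k; apply/val_inj => /=.
have /(congr1 val) := E k; rewrite !ffunE /= => /eqP.
rewrite eqn_modDl !modn_small; first by move/eqP.
  exact: leq_trans (ltn_ord _) le_n.
exact: leq_trans (ltn_ord _) le_n.
Qed.

Lemma place_shift c (x y : L) i : (x i).+1 = y i :> nat ->
  (forall j, j != i -> x j = y j) -> place c y = shift i (place c x).
Proof.
move=> xyi xyj; apply/ffunP => k; rewrite !ffunE; case: eqP => [->|/eqP ki].
  by apply: val_inj; rewrite /= -xyi addnS -[((c i + x i) %% n)%N.+1]addn1 modnDml addn1.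
by apply: val_inj; rewrite /= xyj.
Qed.

Lemma place_adj c (x y : L) : Lambda_adj x y -> torus_adj (place c x) (place c y).
Proof.
case/Lambda_adjP => i [[E|E] xyj]; apply/torus_adjP; exists i; [left|right].
  exact: place_shift.
by apply: place_shift => // j /xyj.
Qed.

Definition set_coord (x : L) i k (lt_k : (k < h.*2.+1)%N) : L :=
  [ffun j => if j == i then Ordinal lt_k else x j].

(** A coordinate at an end of its range would have a neighbour outside the
    box. *)
Lemma interior_coord (x : L) i : x \notin boundary d r ->
  (0 < x i)%N /\ ((x i).+1 < h.*2.+1)%N.
Proof.
rewrite inE => /asboolPn nb.
have in_box s : (`|s|%N = 1%N) -> (2 * `|((x i)%:Z - h%:Z + s)%R| <= r)%N.
  move=> s1; apply: contraT => out; case: nb.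
  exists ([ffun j => if j == i then (x i)%:Z - h%:Z + s else position x j] : Zd d).
  split.
    apply/nearest_neighborP; exists i; rewrite !ffunE eqxx; split.
      by rewrite opprD addrA subrr sub0r abszN.
    by move=> j /negPf ji; rewrite [in RHS]ffunE ji.
  rewrite /in_Lambda negb_forall; apply/existsP; exists i.
  by rewrite ffunE eqxx.
have := in_box 1 erefl; have := in_box (-1) erefl.
by have := ltn_ord (x i); lia.
Qed.

Lemma place_boundary c (x : L) (v : T) : x \notin boundary d r ->
  torus_adj (place c x) v \/ torus_adj v (place c x) ->
  exists y, v = place c y /\ Lambda_adj x y.
Proof.
move=> xb; rewrite (torus_adj_sym v) => H.
have {H}/torus_adjP[i H] : torus_adj (place c x) v by case: H.
have [x_gt0 x_lt] := interior_coord i xb; case: H => [->|E].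
  exists (set_coord x i x_lt); split.
    by apply/esym/place_shift => [|j /negPf ji]; rewrite ffunE ?eqxx ?ji.
  apply/Lambda_adjP; exists i; split; first by left; rewrite ffunE eqxx.
  by move=> j /negPf ji; rewrite ffunE ji.
have x_pred : ((x i).-1 < h.*2.+1)%N by lia.
pose y := set_coord x i x_pred.
have yx : (y i).+1 = x i by rewrite ffunE eqxx /= prednK.
have yj j : j != i -> y j = x j by move=> /negPf ji; rewrite ffunE ji.
exists y; split; last first.
  by apply/Lambda_adjP; exists i; split; [right|move=> j /yj].
have S := place_shift c yx yj; rewrite E in S.
apply/ffunP => k; have /ffunP/(_ k) := S; rewrite /shift 2!ffunE.
case: eqP => // _ /(congr1 val) /=.
rewrite -[(v k).+1]addn1 -[(place c y k).+1]addn1 => /eqP.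
by rewrite eqn_modDr !modn_small ?ltn_ord // => /eqP/val_inj.
Qed.

(** Centre the box at one end of the edge; the other end is at distance one,
    and the condition on [r] puts it in the inner half. *)
Lemma torus_edge_in_box (j : edge (@torus_adj d n)) :
  (4 <= r)%N -> (h.*2.+1 <= n)%N ->
  exists c (e : edge (@Lambda_adj d r)),
    e \in inner_edges d r /\ val j = place c @: val e.
Proof.
move=> r4 hn; have [u [v [/torus_adjP[i uv] jE]]] := edge_ends j.
wlog vE : u v jE {uv} / v = shift i u.
  move=> W; case: uv => E; first exact: (W u v).
  by apply: (W v u) => //; rewrite setUC.
have h_lt : (h < h.*2.+1)%N by lia.
have h1_lt : (h.+1 < h.*2.+1)%N by lia.
(* The centre of the box has all coordinates [h]; adding [n - h] instead of
   subtracting [h] keeps the corner in nat. *)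
pose c : T := [ffun k => Ordinal (ltn_pmod (u k + (n - h)) n_gt0)].
pose x : L := [ffun=> Ordinal h_lt].
pose y : L := set_coord x i h1_lt.
have xyi : (x i).+1 = y i :> nat by rewrite !ffunE eqxx.
have xyj k : k != i -> x k = y k by move=> /negPf ki; rewrite [RHS]ffunE ki.
have exy : [set x; y] \in edge_set (@Lambda_adj d r).
  apply/imsetP; exists (x, y) => //; rewrite inE; apply/Lambda_adjP.
  by exists i; split; [left|].
exists c, (Sub [set x; y] exy : edge (@Lambda_adj d r)).
have cx : place c x = u.
  apply/ffunP => k; apply: val_inj; rewrite !ffunE /= modnDml -addnA.
  by rewrite subnK ?modnDr ?modn_small //; lia.
split; last first.
  rewrite jE /= imsetU1 imset_set1 cx vE; congr [set _; _].
  by rewrite -{1}cx; apply/esym/place_shift.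
rewrite inE; apply/forallP => z; apply/implyP; rewrite !inE => /orP[]/eqP->;
  apply/forallP => k; rewrite !ffunE /=; first by lia.
by case: (k == i) => /=; lia.
Qed.

End TorusGeometry.

Lemma card_Lambda_edge d r : (0 < r)%N ->
  (#|edge (@Lambda_adj d r)| <= (2 * r) ^ (2 * d))%N.
Proof.
move=> r0; rewrite card_sig.
apply: leq_trans (leq_imset_card _ _) _; apply: leq_trans (max_card _) _.
rewrite card_prod card_ffun !card_ord mulnn -expnM mulnC.
by case: (2 * d)%N => // k; rewrite leq_exp2r //; lia.
Qed.

Section WeakMixingMarginal.
Variables (R : realType) (d : nat) (p q : R) (r : nat).

Lemma mass_pushforward (T T' : finType) (f : T -> T') (mu : T -> R) (A : {set T'}) :
  mass (Defs.pushforward f mu) A = \sum_(x | f x \in A) mu x.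
Proof.
rewrite (partition_big f (mem A)) //=; apply: eq_bigr => y yA.
rewrite /Defs.pushforward /mass; apply: eq_bigl => x; rewrite inE.
by case: eqP => [->|]; rewrite ?andbF // yA.
Qed.

Lemma inner_edge_marginals (e : edge (@Lambda_adj d r)) :
  e \in inner_edges d r ->
  \sum_w fk_measure p q (wired_bc d r) w * open_at R e w
    - \sum_w fk_measure p q (free_bc d r) w * open_at R e w
  <= tv_dist (inner_law p q (wired_bc d r)) (inner_law p q (free_bc d r)).
Proof.
move=> ei; pose A : {set config (@Lambda_adj d r)} := [set w : {set _} | e \in w].
have E xi : mass (inner_law p q xi) A = \sum_w fk_measure p q xi w * open_at R e w.
  rewrite mass_pushforward [LHS]big_mkcond; apply: eq_bigr => w _.
  by rewrite inE in_setI ei andbT /open_at; case: (e \in w); rewrite ?mulr1 ?mulr0.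
have le_tv (mu nu : config (@Lambda_adj d r) -> R) :
    mass mu A - mass nu A <= tv_dist mu nu.
  apply: le_trans (ler_norm _) _.
  exact: (le_bigmax _ (fun A => `|mass mu A - mass nu A|) A).
apply: le_trans (le_tv _ _); apply: lerB.
  by rewrite (E (wired_bc d r)).
by rewrite (E (free_bc d r)).
Qed.

End WeakMixingMarginal.

(** * The recursion on the torus *)

(** Raise [1 + x/(m+1) <= exp (x/(m+1))] to the power [m+1]. *)
Lemma expR_ge_power (R : realType) (m : nat) (x : R) : 0 <= x ->
  (x / m.+1%:R) ^+ m.+1 <= expR x.
Proof.
move=> x0; have y0 : 0 <= x / m.+1%:R by rewrite divr_ge0.
have -> : expR x = expR (x / m.+1%:R) ^+ m.+1.
  by rewrite -expRM_natl mulrC divfK ?pnatr_eq0.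
rewrite lerXn2r ?nnegrE ?expR_ge0 //.
by apply: le_trans (expR_ge1Dx _); rewrite lerDr.
Qed.

Lemma power_le_expR (R : realType) (D : nat) (a K : R) : 0 < a -> 0 < K ->
  exists r0 : nat, forall r : nat, (r0 <= r)%N ->
    K * r%:R ^+ D <= expR (a * r%:R).
Proof.
move=> a0 K0; pose c := (a / D.+1%:R) ^+ D.+1.
have c0 : 0 < c by rewrite exprn_gt0 // divr_gt0.
exists (Num.bound (K / c)) => r le_r.
apply: le_trans (expR_ge_power D _); last by rewrite mulr_ge0 // ltW.
rewrite mulrAC exprMn -/c exprSr mulrA [leRHS]mulrAC ler_wpM2r ?exprn_ge0 //.
rewrite mulrC -ler_pdivrMr // (le_trans (ltW (archi_boundP _))) ?ler_nat //.
by rewrite divr_ge0 ?ltW.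
Qed.

Lemma ln_ge1 (R : realType) (N : nat) : (4 <= N)%N -> 1 <= ln N%:R :> R.
Proof.
move=> N4; have N0 : 0 < N%:R :> R by rewrite ltr0n; lia.
rewrite -ler_expR lnK ?posrE //; apply: (@le_trans _ _ 4); last by rewrite (ler_nat _ 4).
have h : expR (2^-1 : R) <= 2.
  have : 2^-1 <= expR (- 2^-1 : R) by apply: le_trans (expR_ge1Dx _); lra.
  by rewrite expRN lef_pV2 ?posrE ?expR_gt0.
have -> : expR 1 = expR (2^-1 : R) ^+ 2 by rewrite -expRM_natl mulfV.
by have := expR_gt0 (2^-1 : R); nra.
Qed.

Section TorusRecursion.
Variables (R : realType) (d : nat) (p q : R).
Hypotheses (hq : 1 <= q) (hp0 : 0 <= p) (hp1 : p <= 1) (hd : (0 < d)%N).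

Definition torus_gap n k e :=
  gap (coin p q) (cycle_rule (adj := @torus_adj d n) set0) Some k e.

Definition box_error r : R :=
  tv_dist (inner_law p q (wired_bc d r)) (inner_law p q (free_bc d r)).

Lemma torus_gap_doubling n r k (b : R) :
  (4 <= r)%N -> (r < n)%N -> (forall e, @torus_gap n k e <= b) ->
  forall e, @torus_gap n (k + k)%N e <= ((2 * r) ^ (2 * d))%:R * b ^+ 2 + box_error r.
Proof.
move=> r4 rn gb j; have n0 : (0 < n)%N by lia.
have rn' : (r./2.*2.+1 <= n)%N by lia.
have [c [e [ei je]]] := torus_edge_in_box n0 j r4 rn'.
have inj := @place_inj d n n0 r c rn'.
have adj := @place_adj d n n0 r c.
have bdy := @place_boundary d n n0 r c.
have -> : j = edge_image adj e by apply: val_inj; rewrite /= -je.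
have S0 := card_torus_edge_gt0 n0 hd.
have G :=
  (gap_doubling (coin_ge0 hq hp0 hp1) (coin_sum1 p q) (coin_free hq hp0 hp1) S0
   (edge_imageK inj adj) (edge_locateK adj)
   (@cycle_rule_mono _ _ _) (@cycle_rule_mono _ _ _) (@cycle_rule_mono _ _ _)
   (fun w f => @cycle_rule_wired _ _ _ _ _ _ inj adj bdy w f)
   (fun w f => @cycle_rule_free _ _ _ _ _ (boundary d r) inj adj w f)
   (fk_measure_ge0 hq hp0 hp1 _) (fk_measure_sum1 hq hp0 hp1 _ _)
   (fk_measure_invariant hq hp1 _)
   (fk_measure_ge0 hq hp0 hp1 _) (fk_measure_sum1 hq hp0 hp1 _ _)
   (fk_measure_invariant hq hp1 _)
   (fk_measure_ge0 hq hp0 hp1 _) (fk_measure_sum1 hq hp0 hp1 _ _)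
   (fk_measure_invariant hq hp1 _) e gb).
apply: le_trans G _.
apply: lerD; last exact: inner_edge_marginals.
by rewrite ler_wpM2r ?sqr_ge0 // ler_nat card_Lambda_edge //; lia.
Qed.

(** The rate involves the box only, so a multiple of the number of torus edges
    suffices as running time, uniformly in [n]. *)
Lemma torus_gap_small_time n r k :
  (4 <= r)%N -> (r < n)%N -> forall e, @torus_gap n k e <= box_error r
    + 4 * expR (- (coalescence_rate (coin p q) #|edge (@Lambda_adj d r)|
                    / #|edge (@torus_adj d n)|%:R * k%:R)).
Proof.
move=> r4 rn j; have n0 : (0 < n)%N by lia.
have rn' : (r./2.*2.+1 <= n)%N by lia.
have [c [e [ei je]]] := torus_edge_in_box n0 j r4 rn'.
have inj := @place_inj d n n0 r c rn'.
have adj := @place_adj d n n0 r c.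
have bdy := @place_boundary d n n0 r c.
have -> : j = edge_image adj e by apply: val_inj; rewrite /= -je.
have S0 := card_torus_edge_gt0 n0 hd.
apply: le_trans
  (gap_small_time (coin_ge0 hq hp0 hp1) (coin_sum1 p q) (coin_free hq hp0 hp1) S0
   (edge_imageK inj adj) (edge_locateK adj)
   (@cycle_rule_mono _ _ _) (@cycle_rule_mono _ _ _)
   (fun w f => @cycle_rule_wired _ _ _ _ _ _ inj adj bdy w f)
   (fun w f => @cycle_rule_free _ _ _ _ _ (boundary d r) inj adj w f)
   (fk_measure_ge0 hq hp0 hp1 _) (fk_measure_sum1 hq hp0 hp1 _ _)
   (fk_measure_invariant hq hp1 _)
   (fk_measure_ge0 hq hp0 hp1 _) (fk_measure_sum1 hq hp0 hp1 _ _)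
   (fk_measure_invariant hq hp1 _) k e) _.
by rewrite lerD2r; exact: inner_edge_marginals.
Qed.

End TorusRecursion.

(** * Exponential decay along geometric scales *)

Section Multiscale.
Variables (R : realType) (d : nat) (p q C : R).
Hypotheses (hq : 1 <= q) (hp0 : 0 <= p) (hp1 : p <= 1) (hd : (0 < d)%N).
Hypotheses (C_gt0 : 0 < C)
  (wsm : forall r, box_error d p q r <= C * expR (- (r%:R / C))).

Let D := (2 * d)%N.
Let c : R := (4 * C)^-1.
Let al : R := 2 * 4 ^+ D.

(** The solution of the recursion: the polynomial factor is what makes the
    squaring step exact in [scale_bound_double], the exponential rate is slow enough
    to absorb that factor in [scale_bound_error]. *)
Definition scale_bound (r : nat) : R := expR (- (c * r%:R)) / (al * r%:R ^+ D).

Let c_gt0 : 0 < c. Proof. by rewrite invr_gt0 mulr_gt0. Qed.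
Let al_gt0 : 0 < al. Proof. by rewrite mulr_gt0 ?exprn_gt0. Qed.

Lemma scale_bound_gt0 r : (0 < r)%N -> 0 < scale_bound r.
Proof. by move=> r0; rewrite divr_gt0 ?expR_gt0 // mulr_gt0 // exprn_gt0 // ltr0n. Qed.

Lemma scale_bound_le r : (0 < r)%N -> scale_bound r <= expR (- (c * r%:R)).
Proof.
move=> r0; rewrite ler_pdivrMr; last by rewrite mulr_gt0 // exprn_gt0 // ltr0n.
rewrite ler_peMr ?expR_ge0 // mulr_ege1 ?exprn_ege1 ?ler1n //.
by rewrite mulr_ege1 ?exprn_ege1 // ler1n.
Qed.

Lemma scale_bound_double r : (0 < r)%N ->
  ((2 * r) ^ (2 * d))%:R * scale_bound r ^+ 2 = scale_bound (2 * r) / 2.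
Proof.
move=> r0; have rD : r%:R ^+ D != 0 :> R by rewrite expf_neq0 // pnatr_eq0 -lt0n.
have D2 : 2 ^+ D != 0 :> R by rewrite expf_neq0.
rewrite /scale_bound -/D natrX natrM exprMn /al.
have -> : expR (- (c * (2 * r%:R))) = expR (- (c * r%:R)) ^+ 2.
  by rewrite -expRM_natl; congr expR; rewrite mulrN; congr (- _); ring.
have -> : (4 ^+ D = 2 ^+ D * 2 ^+ D :> R) by rewrite -exprMn; congr (_ ^+ _); ring.
move: (r%:R ^+ D) (2 ^+ D) (expR _) rD D2 => x y z x0 y0; field.
by rewrite x0 y0.
Qed.

Lemma scale_bound_error : exists r1 : nat, forall r, (r1 <= r)%N -> (0 < r)%N ->
  C * expR (- (r%:R / C)) <= scale_bound (2 * r) / 2.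
Proof.
have K_gt0 : 0 < 2 * C * al * 2 ^+ D by rewrite !mulr_gt0 ?exprn_gt0.
have a_gt0 : 0 < (2 * C)^-1 by rewrite invr_gt0 mulr_gt0.
have [r1 H] := power_le_expR D a_gt0 K_gt0; exists r1 => r /H le r0.
have r_gt0 : 0 < r%:R :> R by rewrite ltr0n.
rewrite /scale_bound -mulrA -invfM ler_pdivlMr; last first.
  by rewrite !mulr_gt0 // exprn_gt0 // natrM mulr_gt0.
have -> : expR (- (c * (2 * r)%:R)) = expR ((2 * C)^-1 * r%:R) * expR (- (r%:R / C)).
  rewrite -expRD; congr expR; rewrite natrM /c; field; exact: lt0r_neq0.
rewrite natrM exprMn.
apply: le_trans (ler_wpM2r (expR_ge0 _) le); rewrite le_eqVlt; apply/orP; left.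
by apply/eqP; move: (expR _) (2 ^+ D) (r%:R ^+ D) => x y z; ring.
Qed.

Lemma torus_gap_scales : exists r0 s0 : nat, (0 < r0)%N /\ (0 < s0)%N /\
  forall n, (r0 < n)%N -> forall j, (2 ^ j * r0 < 2 * n)%N -> forall e,
    @torus_gap R d p q n (2 ^ j * (s0 * #|edge (@torus_adj d n)|)) e
      <= scale_bound (2 ^ j * r0).
Proof.
have [r1 err] := scale_bound_error.
pose r0 := (r1 + 4)%N; have r0_gt0 : (0 < r0)%N by rewrite /r0; lia.
pose rt : R := coalescence_rate (coin p q) #|edge (@Lambda_adj d r0)|.
have rt_gt0 : 0 < rt by rewrite coalescence_rate_gt0 // coin_free.
have sb0 := scale_bound_gt0 r0_gt0.
have [|s hs] := @expR_small R rt (scale_bound r0 / 8) rt_gt0; first by rewrite divr_gt0.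
exists r0, s.+1; split=> //; split=> // n rn; elim=> [|j IH] hj e.
  rewrite !expn0 !mul1n; have n0 : (0 < n)%N by exact: leq_ltn_trans rn.
  have r4 : (4 <= r0)%N by exact: leq_addl.
  apply: le_trans (torus_gap_small_time hq hp0 hp1 hd _ r4 rn e) _.
  have E0 : #|edge (@torus_adj d n)|%:R != 0 :> R.
    by rewrite pnatr_eq0 -lt0n card_torus_edge_gt0.
  have b1 : box_error d p q r0 <= scale_bound r0 / 2.
    apply: le_trans (wsm r0) _; apply: le_trans (err r0 _ r0_gt0) _.
      exact: leq_addr.
    rewrite ler_pM2r ?invr_gt0 // /scale_bound natrM.
    apply: ler_pM; rewrite ?expR_ge0 ?invr_ge0 ?mulr_ge0 ?exprn_ge0 ?(ltW al_gt0) //.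
      rewrite ler_expR lerN2 ler_wpM2l ?(ltW c_gt0) // ler_peMl // ler1n //.
    have x0 : 0 < r0%:R ^+ D :> R by rewrite exprn_gt0 // ltr0n.
    have y0 : 0 < 2 * r0%:R :> R by rewrite mulr_gt0 // ltr0n.
    rewrite lef_pV2 ?posrE ?mulr_gt0 ?(exprn_gt0 _ y0) //.
    rewrite ler_wpM2l ?(ltW al_gt0) // exprMn ler_peMl ?(ltW x0) //.
    by rewrite exprn_ege1 // ler1n.
  have b2 : expR (- (rt / #|edge (@torus_adj d n)|%:R
                * (s.+1 * #|edge (@torus_adj d n)|)%:R)) <= scale_bound r0 / 8.
    apply: le_trans hs; rewrite ler_expR lerN2 natrM.
    have -> : rt / #|edge (@torus_adj d n)|%:R
        * (s.+1%:R * #|edge (@torus_adj d n)|%:R) = rt * s.+1%:R by field.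
    by rewrite ler_pM2l // ler_nat.
  by rewrite -/rt; lra.
have hj' : (2 ^ j * r0 < n)%N by move: hj; rewrite expnS -mulnA ltn_pmul2l.
set k := (2 ^ j * (s.+1 * _))%N in IH.
have -> : (2 ^ j.+1 * (s.+1 * #|edge (@torus_adj d n)|) = k + k)%N.
  by rewrite expnS -mulnA addnn -mul2n.
have pj : (0 < 2 ^ j)%N by rewrite expn_gt0.
have r4 : (4 <= 2 ^ j * r0)%N by rewrite /r0; move: pj; clear; nia.
have rj : (0 < 2 ^ j * r0)%N by rewrite (leq_trans _ r4).
apply: le_trans (torus_gap_doubling hq hp0 hp1 hd r4 hj' (IH _) e) _.
  by apply: ltn_trans hj' _; rewrite ltn_Pmull // (leq_ltn_trans _ rn).
rewrite expnS -mulnA scale_bound_double //.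
have := err (2 ^ j * r0)%N _ rj; have := wsm (2 ^ j * r0)%N.
move=> h1 h2; have {}h2 := le_trans h1 (h2 _); rewrite [leRHS]splitr lerD2l.
apply: h2; move: r4 pj; rewrite /r0; clear; nia.
Qed.

(** The number [j] of doublings makes [2^j] comparable with [ln N], with a
    constant that lets [exp (c 2^j r0)] exceed [8 d N], where [d N] bounds the
    number of edges.  For large [n] a box of this logarithmic size fits in the
    torus. *)
Lemma torus_gap_log_time : exists (K : R) (n0 : nat), 0 < K /\
  forall n, (n0 <= n)%N -> exists k : nat, (0 < k)%N /\
    k%:R <= K * (#|edge (@torus_adj d n)|%:R * ln (n ^ d)%:R) /\
    \sum_e @torus_gap R d p q n k e <= 8^-1.
Proof.
have [r0 [s0 [r0_gt0 [s0_gt0 H]]]] := torus_gap_scales.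
have r0R : 0 < r0%:R :> R by rewrite ltr0n.
pose A : R := (ln (8 * d)%:R + 1) / (c * r0%:R).
have ln8 : 0 <= ln (8 * d)%:R :> R by rewrite ln_ge0 // ler1n muln_gt0.
have A_gt0 : 0 < A by rewrite divr_gt0 ?mulr_gt0 //; lra.
pose B : R := 2 * (A + 1).
have B_gt0 : 0 < B by rewrite /B; lra.
pose a : R := (B * r0%:R * d%:R)^-1.
have dR : 0 < d%:R :> R by rewrite ltr0n.
have a_gt0 : 0 < a by rewrite invr_gt0; do 2?apply: mulr_gt0.
have [n1 Hn1] := power_le_expR 1 a_gt0 (ltr01 : 0 < 1 :> R).
exists (B * s0%:R), (n1 + r0 + 4)%N; split; first by rewrite mulr_gt0 ?ltr0n.
move=> n le_n; have n_gt0 : (0 < n)%N by move: le_n; clear; lia.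
have nR : 0 < n%:R :> R by rewrite ltr0n.
set N := (n ^ d)%N; have N4 : (4 <= N)%N.
  apply: (@leq_trans n); first by move: le_n; clear; lia.
  by rewrite -[X in (X <= _)%N]expn1 leq_pexp2l.
have l1 := ln_ge1 R N4; set l : R := ln N%:R in l1 *.
have lE : l = d%:R * ln n%:R by rewrite /l /N natrX lnXn // mulr_natl.
have NR : 0 < N%:R :> R by rewrite ltr0n (leq_trans _ N4).
have Al0 : 0 <= A * l by rewrite mulr_ge0; lra.
pose m := (Num.truncn (A * l)).+1.
have m_ge : A * l <= m%:R by rewrite ltW // truncnS_gt.
have m_le : m%:R <= A * l + 1 by rewrite -natr1 lerD2r truncn_le.
have [j [j_ge j_le]] : exists j, (m <= 2 ^ j)%N /\ (2 ^ j <= 2 * m)%N.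
  have m_gt0 : (0 < m)%N by [].
  case: (leqP m 1) => m1.
    by exists 0%N; rewrite expn0; split=> //; rewrite muln_gt0.
  exists (up_log 2 m); have /andP[] := up_log_bounds (isT : (1 < 2)%N) m1.
  case: (up_log 2 m) => [|j] /=.
    by rewrite expn0 [(m <= 1)%N]leqNgt m1.
  by rewrite expnS => lt_j ->; rewrite leq_mul2l ltnW.
have tj : (2 ^ j)%:R <= B * l :> R.
  apply: (@le_trans _ _ (2 * m)%:R); first by rewrite ler_nat.
  by rewrite natrM /B; nra.
have fits : (2 ^ j * r0 < 2 * n)%N.
  rewrite -(ltr_nat R) !natrM; apply: (@le_lt_trans _ _ n%:R); last by lra.
  apply: (@le_trans _ _ (B * l * r0%:R)); first by rewrite ler_pM2r.
  have : ln n%:R <= a * n%:R.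
    rewrite -ler_expR lnK ?posrE //; have := Hn1 n; rewrite mul1r expr1; apply.
    by move: le_n; clear; lia.
  rewrite /a mulrC ler_pdivlMr; last by rewrite -invr_gt0.
  by rewrite lE; move: (ln _) => x; lra.
have rn : (r0 < n)%N by move: le_n; clear; lia.
set E := #|edge (@torus_adj d n)|.
have E_gt0 : (0 < E)%N by exact: card_torus_edge_gt0.
exists (2 ^ j * (s0 * E))%N; split; first by rewrite !muln_gt0 expn_gt0 s0_gt0.
split.
  rewrite !natrM; set t := (2 ^ j)%:R in tj *.
  have -> : B * s0%:R * (E%:R * l) = (B * l) * (s0%:R * E%:R) by ring.
  by rewrite ler_wpM2r // mulr_ge0.
apply: (@le_trans _ _ (\sum_(e : edge (@torus_adj d n)) expR (- (c * (2 ^ j * r0)%:R)))).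
  apply: ler_sum => e _; apply: le_trans (H n rn j fits e) (scale_bound_le _).
  by rewrite muln_gt0 expn_gt0.
rewrite sumr_const -[_ *+ _]mulr_natl -/E.
apply: (@le_trans _ _ ((d * N)%:R * (8 * (d * N))%:R^-1)); last first.
  have dN : (d * N)%:R != 0 :> R.
    by rewrite pnatr_eq0 muln_eq0 negb_or -!lt0n hd (leq_trans _ N4).
  by rewrite [(8 * _)%:R]natrM invfM mulrCA mulfV // mulr1.
apply: ler_pM; rewrite ?expR_ge0 ?ler_nat ?card_torus_edge //.
have dNR : 0 < (8 * (d * N))%:R :> R by rewrite ltr0n !muln_gt0 hd (leq_trans _ N4).
rewrite expRN lef_pV2 ?posrE ?expR_gt0 // -[leLHS]lnK ?posrE // ler_expR.
rewrite mulnA natrM lnM ?posrE // ?ltr0n ?muln_gt0 ?hd //.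
rewrite -/l [in leRHS]natrM; set t := (2 ^ j)%:R.
have At : A * l <= t by apply: le_trans m_ge _; rewrite ler_nat.
have cr0 : 0 < c * r0%:R by rewrite mulr_gt0.
have AE : A * (c * r0%:R) = ln (8 * d)%:R + 1 by rewrite divfK ?gt_eqF.
apply: (@le_trans _ _ (A * l * (c * r0%:R))).
  by rewrite mulrAC AE; move: (l) (ln _) l1 ln8 => x y; nra.
have -> : c * (t * r0%:R) = t * (c * r0%:R) by ring.
by rewrite ler_wpM2r // ltW.
Qed.

End Multiscale.

(** * From forgetting the initial state to mixing times *)

Section PoissonAverage.
Variable R : realType.

Definition poisson_weight (la : R) (m : nat) : R := expR (- la) * la ^+ m / m`!%:R.

Lemma poisson_weight_ge0 la m : 0 <= la -> 0 <= poisson_weight la m.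
Proof. by move=> la0; rewrite divr_ge0 // mulr_ge0 ?expR_ge0 ?exprn_ge0. Qed.

Lemma poisson_weightE la : poisson_weight la = expR (- la) *: exp_coeff la.
Proof. by apply: funext => m; rewrite /poisson_weight /exp_coeff /= -mulrA. Qed.

Lemma poisson_weight_cvg la : cvgn (series (poisson_weight la)).
Proof.
rewrite poisson_weightE; apply: is_cvg_seriesZ; exact: is_cvg_series_exp_coeff.
Qed.

Lemma poisson_weight_lim la : limn (series (poisson_weight la)) = 1.
Proof.
rewrite poisson_weightE lim_seriesZ; last exact: is_cvg_series_exp_coeff.
by rewrite -[limn _]/(expR la) /GRing.scale /= -expRD addNr expR0.
Qed.

Lemma poisson_weight_partial la N : 0 <= la -> series (poisson_weight la) N <= 1.
Proof.
move=> la0; rewrite -(poisson_weight_lim la).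
apply: nondecreasing_cvgn_le; last exact: poisson_weight_cvg.
apply: nondecreasing_series => m _ _; exact: poisson_weight_ge0.
Qed.

(** Exponential moment: [2^m <= 2^k] for [m < k] compares the weight of mean
    [la] with that of mean [la/2]. *)
Lemma poisson_lower_tail la k N : 0 <= la ->
  \sum_(0 <= m < N) poisson_weight la m * (m < k)%N%:R <= 2 ^+ k * expR (- (la / 2)).
Proof.
move=> la0; have la20 : 0 <= la / 2 by rewrite divr_ge0.
apply: (@le_trans _ _ (2 ^+ k * expR (- (la / 2)) * series (poisson_weight (la / 2)) N)).
  rewrite /series /= mulr_sumr; apply: ler_sum => m _.
  case: ltnP => mk; last first.
    by rewrite mulr0 !mulr_ge0 ?exprn_ge0 ?expR_ge0 ?poisson_weight_ge0.
  have -> : poisson_weight la m * 1 =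
      2 ^+ m * (expR (- (la / 2)) * poisson_weight (la / 2) m).
    rewrite /poisson_weight [- la]splitr mulr1 -mulNr expRD expr_div_n.
    field; rewrite expf_neq0 // pnatr_eq0 -lt0n fact_gt0 //.
  rewrite -[leRHS]mulrA ler_wpM2r //.
    by apply: mulr_ge0; [exact: expR_ge0|exact: poisson_weight_ge0].
  by rewrite ler_eXn2l ?ltr1n // ltnW.
by rewrite ler_piMr ?poisson_weight_partial.
Qed.

(** The terms before time [k] contribute at most the lower tail, the later ones
    at most [de].  The estimate is made on partial sums and passed to the
    limit. *)
Lemma poisson_average (T : finType) (A : {set T}) (a : nat -> T -> R)
    (v la de : R) (k : nat) : 0 <= la -> 0 <= de ->
  (forall m y, 0 <= a m y <= 1) ->
  (forall m, `|\sum_(y in A) a m y - v| <= 1) ->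
  (forall m, (k <= m)%N -> `|\sum_(y in A) a m y - v| <= de) ->
  `|\sum_(y in A) limn (series (fun m => poisson_weight la m * a m y)) - v|
    <= 2 ^+ k * expR (- (la / 2)) + de.
Proof.
move=> la0 de0 a01 near1 near_de.
pose s N := \sum_(y in A) series (fun m => poisson_weight la m * a m y) N
            - v * series (poisson_weight la) N.
have sE N : s N = \sum_(0 <= m < N) poisson_weight la m * (\sum_(y in A) a m y - v).
  rewrite /s /series /= exchange_big /= mulr_sumr -sumrB.
  by apply: eq_bigr => m _; rewrite mulrBr mulr_sumr [v * _]mulrC.
have s_cvg : (s N @[N --> \oo] -->
    \sum_(y in A) limn (series (fun m => poisson_weight la m * a m y)) - v)%classic.
  rewrite -[X in _ - X]mulr1 -[X in _ * X](poisson_weight_lim la).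
  apply: cvgB; last first.
    by apply: cvgM; [exact: cvg_cst|exact: poisson_weight_cvg].
  apply: cvg_big => [|y _]; first exact: add_continuous.
  suff : cvgn (series (fun m => poisson_weight la m * a m y)) by [].
  apply: (@series_le_cvg _ _ (poisson_weight la)) => [m|m|m|].
  - by have /andP[a0 _] := a01 m y; rewrite mulr_ge0 ?poisson_weight_ge0.
  - exact: poisson_weight_ge0.
  - by have /andP[_ a1] := a01 m y; rewrite ler_piMr ?poisson_weight_ge0.
  exact: poisson_weight_cvg.
apply: (cvgr_to_le (cvg_norm s_cvg)); apply: nearW => N; rewrite sE.
apply: le_trans (ler_norm_sum _ _ _) _.
apply: (@le_trans _ _ (\sum_(0 <= m < N)
    (poisson_weight la m * (m < k)%N%:R + poisson_weight la m * de))).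
  apply: ler_sum => m _; have w0 := poisson_weight_ge0 m la0.
  rewrite normrM ger0_norm // -mulrDr ler_wpM2l //.
  case: ltnP => mk; last by rewrite add0r near_de.
  by rewrite (le_trans (near1 m)) // lerDl.
rewrite big_split /= lerD ?poisson_lower_tail //.
by rewrite -mulr_suml ler_piMl // poisson_weight_partial.
Qed.

Lemma poisson_tail_bound k : (0 < k)%N ->
  2 ^+ k * expR (- ((8 * k)%:R / 2)) <= 8^-1 :> R.
Proof.
move=> k0.
have e1 : expR (- 1) <= 2^-1 :> R.
  by rewrite expRN lef_pV2 ?posrE ?expR_gt0 //; have := expR_ge1Dx (1 : R); lra.
have -> : expR (- ((8 * k)%:R / 2)) = expR (- 1) ^+ 4 ^+ k :> R.
  by rewrite -!expRM_natl; congr expR; rewrite natrM; field.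
rewrite -exprMn; have b : 2 * expR (- 1) ^+ 4 <= 8^-1 :> R.
  have -> : 8^-1 = 2 * 2^-1 ^+ 4 :> R by field.
  by rewrite ler_pM2l // lerXn2r ?nnegrE ?expR_ge0 // invr_ge0.
have b0 : 0 <= 2 * expR (- 1) ^+ 4 :> R by rewrite mulr_ge0 ?exprn_ge0 ?expR_ge0.
rewrite -(prednK k0) exprS -[leRHS]mulr1; apply: ler_pM;
  rewrite ?exprn_ge0 // exprn_ile1 //; lra.
Qed.

End PoissonAverage.

Section MixingTimes.
Variables (R : realType) (p q : R).
Hypotheses (hq : 1 <= q) (hp0 : 0 <= p) (hp1 : p <= 1).
Variables (V : finType) (adj : rel V).
Local Notation E := (edge adj).
Hypothesis E_gt0 : (0 < #|E|)%N.
Variable xi : {set {set V}}.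
Local Notation P := (trans (coin p q) (cycle_rule (adj := adj) xi) Some).
Local Notation pi := (fk_measure p q (adj := adj) xi).

(** A bound on the influence of the initial state on all events.  It does not
    mention the invariant law and is inherited by later times
    ([forgets_later]). *)
Definition forgets k (de : R) := forall (f : {set E} -> R) x y,
  (forall z, 0 <= f z <= 1) -> P k f x - P k f y <= de.

Let th0 := coin_ge0 hq hp0 hp1.
Let th1 := coin_sum1 p q.

Lemma forgets_later k k' de : (k <= k')%N -> forgets k de -> forgets k' de.
Proof.
move=> /subnK <- F f x y f01; rewrite !trans_add.
(* The values of [g] lie within [de] of each other, hence so do its averages. *)
set l := (k' - k)%N; set g := P k f.
have up z : P l g x <= g z + de.
  rewrite -[leRHS](trans_cst th1 E_gt0 (cycle_rule xi) Some l _ x).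
  by apply: ler_trans_rule => // u; rewrite -lerBlDl; exact: F.
rewrite lerBlDl -lerBlDr.
rewrite -[leLHS](trans_cst th1 E_gt0 (cycle_rule xi) Some l _ y).
by apply: ler_trans_rule => // z; rewrite lerBlDr.
Qed.

Lemma mass_law_after k x A :
  mass (law_after (fk_kernel p q (adj := adj) xi) k x) A =
    P k (fun w => (w \in A)%:R) x.
Proof.
rewrite -law_after_trans /mass big_mkcond; apply: eq_bigr => w _.
by case: (w \in A); rewrite ?mulr1 ?mulr0.
Qed.

Lemma mass_fk_measure k A : mass pi A = \sum_w pi w * P k (fun w => (w \in A)%:R) w.
Proof.
rewrite (trans_invariant th1 E_gt0 Some k _ (fk_measure_invariant hq hp1 xi)).
rewrite /mass big_mkcond; apply: eq_bigr => w _.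
by case: (w \in A); rewrite ?mulr1 ?mulr0.
Qed.

Lemma forgets_mass k de x A : forgets k de ->
  `|mass (law_after (fk_kernel p q (adj := adj) xi) k x) A - mass pi A| <= de.
Proof.
move=> F; rewrite mass_law_after (mass_fk_measure k).
have s1 : \sum_w pi w = 1 := fk_measure_sum1 hq hp0 hp1 adj xi.
have C c : c = \sum_w pi w * c by rewrite -mulr_suml s1 mul1r.
rewrite [X in `|X - _|]C -sumrB; apply: le_trans (ler_norm_sum _ _ _) _.
rewrite [leRHS]C; apply: ler_sum => w _.
have i01 (z : {set E}) : 0 <= ((z \in A)%:R : R) <= 1.
  by case: (z \in A); rewrite lexx ler01.
rewrite -mulrBr normrM ger0_norm ?fk_measure_ge0 // ler_wpM2l ?fk_measure_ge0 //.
by rewrite ler_norml lerNl opprB; apply/andP; split; apply: F.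
Qed.

Lemma fk_mass01 A : 0 <= mass pi A <= 1.
Proof.
rewrite /mass sumr_ge0 => [|w _]; last exact: fk_measure_ge0.
rewrite -(fk_measure_sum1 hq hp0 hp1 adj xi) [leRHS](bigID (mem A)) /= lerDl.
by rewrite sumr_ge0 // => w _; exact: fk_measure_ge0.
Qed.

Lemma law_mass01 k x A :
  0 <= mass (law_after (fk_kernel p q (adj := adj) xi) k x) A <= 1.
Proof.
rewrite mass_law_after; apply: trans_bound => // z.
by case: (z \in A); rewrite lexx ler01.
Qed.

Lemma tv_dist_le (T : finType) (mu nu : T -> R) (de : R) : 0 <= de ->
  (forall A, `|mass mu A - mass nu A| <= de) -> tv_dist mu nu <= de.
Proof. by move=> de0 H; apply: bigmax_le. Qed.

Lemma mixing_time_le k : forgets k 4^-1 ->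
  (mixing_time (fk_kernel p q (adj := adj) xi) pi <= k%:R%:E)%E.
Proof.
move=> F; apply: ereal_inf_lbound; exists k => //=.
apply: bigmax_le => [|x _]; first by rewrite invr_ge0.
by apply: tv_dist_le => [|A]; rewrite ?invr_ge0 //; exact: forgets_mass.
Qed.

Lemma mixing_time_cont_le k : (0 < k)%N -> forgets k 8^-1 ->
  (mixing_time_cont (fk_kernel p q (adj := adj) xi) #|E|%:R pi
    <= ((8 * k)%:R / #|E|%:R)%:E)%E.
Proof.
move=> k0 F; apply: ereal_inf_lbound; exists ((8 * k)%:R / #|E|%:R) => //=.
split; first by rewrite divr_ge0.
apply: bigmax_le => [|x _]; first by rewrite invr_ge0.
apply: tv_dist_le => [|A]; first by rewrite invr_ge0.
have ER : #|E|%:R != 0 :> R by rewrite pnatr_eq0 -lt0n.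
(* At time [8 k / #|E|] the clock of rate [#|E|] has mean [8 k]. *)
rewrite {1}/mass /law_at mulrC divfK //.
apply: le_trans (poisson_average (k := k) (de := 8^-1) _ _ _ _ _) _.
- exact: ler0n.
- by rewrite invr_ge0.
- move=> m y; have := law_mass01 m x [set y].
  by rewrite /mass big_set1.
- move=> m; have := law_mass01 m x A; have := fk_mass01 A; rewrite /mass.
  by move=> /andP[a b] /andP[c e]; rewrite ler_norml; apply/andP; split; lra.
- by move=> m km; apply: forgets_mass; exact: forgets_later km F.
by have := poisson_tail_bound R k0; lra.
Qed.

(** Coalescence with the graph driving itself; this serves the finitely many
    small tori. *)
Lemma forgets_exists : exists2 k : nat, (0 < k)%N & forgets k 8^-1.
Proof.
have rt : 0 < coalescence_rate (coin p q) #|E| / #|E|%:R.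
  by rewrite divr_gt0 ?ltr0n // coalescence_rate_gt0 // coin_free.
have [|k hk] := @expR_small R _ (16^-1) rt; first by rewrite invr_gt0.
have F : forgets k 8^-1.
  move=> f x y f01.
  apply: le_trans (trans_contraction (emb := id) th0 th1 (coin_free hq hp0 hp1)
    E_gt0 _ _ (cycle_rule xi) k x y f01) _ => //.
  by move: hk; move: (expR _) => z; lra.
by exists k.+1 => //; exact: forgets_later (leqnSn k) F.
Qed.

End MixingTimes.

(** * Logarithmic relaxation on the torus *)

Lemma torus_forgets_log_time (R : realType) (d : nat) (p q C : R) :
  (2 <= d)%N -> 1 <= q -> 0 <= p -> p <= 1 -> 0 < C ->
  (forall r, box_error d p q r <= C * expR (- (r%:R / C))) ->
  exists K : R, 0 < K /\ forall n, (2 <= n)%N -> exists k : nat, (0 < k)%N /\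
    k%:R <= K * (#|edge (@torus_adj d n)|%:R * ln (n ^ d)%:R) /\
    forgets p q (@torus_adj d n) set0 k 8^-1.
Proof.
move=> d2 hq hp0 hp1 C0 wsm; have hd : (0 < d)%N by apply: ltn_trans d2.
have [K [n0 [K0 large]]] := torus_gap_log_time hq hp0 hp1 hd C0 wsm.
have cost_ge1 n : (2 <= n)%N ->
    1 <= #|edge (@torus_adj d n)|%:R * ln (n ^ d)%:R :> R.
  move=> n2; have E1 : 1 <= #|edge (@torus_adj d n)|%:R :> R.
    by rewrite ler1n card_torus_edge_gt0 // (leq_trans _ n2).
  have L1 : 1 <= ln (n ^ d)%:R :> R.
    apply: ln_ge1; apply: (@leq_trans (2 ^ d)%N).
      by rewrite -[4%N]/(2 ^ 2)%N leq_exp2l.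
    by rewrite leq_exp2r.
  by rewrite mulr_ege1.
have small m : exists K' : R, 0 < K' /\ forall n, (2 <= n)%N -> (n < m)%N ->
    exists k : nat, (0 < k)%N /\
    k%:R <= K' * (#|edge (@torus_adj d n)|%:R * ln (n ^ d)%:R) /\
    forgets p q (@torus_adj d n) set0 k 8^-1.
  elim: m => [|m [K' [K'0 IH]]]; first by exists 1.
  have [m2|m2] := ltnP m 2.
    exists K'; split=> // n n2; rewrite ltnS => /leq_ltn_trans/(_ m2).
    by rewrite ltnNge n2.
  have Em : (0 < #|edge (@torus_adj d m)|)%N.
    by rewrite card_torus_edge_gt0 // (leq_trans _ m2).
  have [k k0 F] := forgets_exists hq hp0 hp1 Em set0.
  exists (K' + k%:R); split; first by rewrite ltr_wpDr.
  move=> n n2; rewrite ltnS leq_eqVlt => /orP[/eqP->|nm]; last first.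
    have [l [l0 [l1 l2]]] := IH n n2 nm; exists l; split=> //; split=> //.
    apply: le_trans l1 _; rewrite ler_wpM2r ?lerDl //.
    exact: le_trans ler01 (cost_ge1 n n2).
  exists k; split=> //; split=> //.
  apply: (@le_trans _ _ (k%:R * 1)); first by rewrite mulr1.
  by apply: ler_pM => //; rewrite ?lerDr ?cost_ge1 // ltW.
have [K' [K'0 Hs]] := small n0; exists (K + K'); split; first exact: addr_gt0.
move=> n n2; have cost0 := le_trans ler01 (cost_ge1 n n2).
have [/(Hs n n2)[k [k0 [k1 k2]]]|/large[k [k0 [k1 k2]]]] := ltnP n n0.
  exists k; split=> //; split=> //.
  by apply: le_trans k1 _; rewrite ler_wpM2r // lerDr ltW.
exists k; split=> //; split.
  by apply: le_trans k1 _; rewrite ler_wpM2r // lerDl ltW.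
move=> f x y f01.
have G := trans_gap Some k x y (coin_ge0 hq hp0 hp1)
  (@cycle_rule_mono _ (@torus_adj d n) set0) f01.
exact: le_trans G k2.
Qed.

Theorem theorem1p1 (R : realType) (d : nat) (p q : R)
    (hd : (2 <= d)%N) (hq : 1 <= q) (hp0 : 0 <= p) (hp1 : p <= 1)
    (hwsm : weak_spatial_mixing d p q) :
  (exists C : R, 0 < C /\ forall n : nat, (2 <= n)%N ->
     (fk_mixing_time p q (@torus_adj d n)
        <= (C * ((n ^ d)%:R * ln (n ^ d)%:R))%:E)%E)
  /\
  (exists C : R, 0 < C /\ forall n : nat, (2 <= n)%N ->
     (fk_mixing_time_cont p q (@torus_adj d n)
        <= (C * ln (n ^ d)%:R)%:E)%E).
Proof.
have [C [C0 wsm]] := hwsm.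
have [K [K0 H]] := torus_forgets_log_time hd hq hp0 hp1 C0 wsm.
have d0 : (0 < d)%N by apply: leq_trans hd.
have lnN n : (2 <= n)%N -> 0 <= ln (n ^ d)%:R :> R.
  by move=> n2; rewrite ln_ge0 // ler1n expn_gt0 (leq_trans _ n2).
split.
  exists (K * d%:R); split; first by rewrite mulr_gt0 // ltr0n.
  move=> n n2; have n0 : (0 < n)%N by apply: leq_trans n2.
  have [k [k0 [k_le F]]] := H n n2.
  have E0 := card_torus_edge_gt0 n0 d0.
  apply: le_trans (mixing_time_le hq hp0 hp1 E0 (k := k) _) _.
    move=> f x y f01; apply: le_trans (F f x y f01) _.
    by rewrite lef_pV2 ?posrE // ler_nat.
  rewrite lee_fin; apply: le_trans k_le _; rewrite -!mulrA.
  rewrite ler_wpM2l ?(ltW K0) // mulrA ler_wpM2r ?lnN // -natrM ler_nat.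
  exact: card_torus_edge.
exists (8 * K); split; first by rewrite mulr_gt0.
move=> n n2; have n0 : (0 < n)%N by apply: leq_trans n2.
have [k [k0 [k_le F]]] := H n n2.
have E0 := card_torus_edge_gt0 n0 d0.
apply: le_trans (mixing_time_cont_le hq hp0 hp1 E0 k0 F) _.
rewrite lee_fin ler_pdivrMr ?ltr0n // natrM -!mulrA ler_wpM2l //.
by rewrite [ln _ * _]mulrC.
Qed.
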